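(* Suppose there is a family of list-decodable binary codes with parameters $(\alpha,R(\alpha),L)$, i.e. codes of length $n$ and rate $R(\alpha)$ such that the $\alpha n$-neighbourhood of every word of $\{0,1\}^n$ contains at most $L$ codewords, and suppose that: (1) the codes are linear; (2) $L=O(\mathrm{poly}(n))$, i.e. $L$ does not exceed some polynomial in $n$; (3) there is an efficient list-decoding algorithm which, for every $y\in\{0,1\}^n$, finds the list of the (at most $L$) codewords $z_i$ with $\rho(y,z_i)\le\alpha n$. Then one can construct from these codes a three-round (deterministic) communication protocol for the file synchronization problem with communication complexity $$C=(1-R(\alpha))\,n+o(n).$$ The computational complexity of this protocol is $T_{\mathrm{code}}+O(L^3n^3)$, where $T_{\mathrm{code}}$ is the computational complexity of the code (of its list-decoding algorithm).
   Context: $\rho$ denotes the Hamming distance. File synchronization problem: Alice holds $X\in\{0,1\}^n$, Bob holds $Y\in\{0,1\}^n$, and it is known in advance that $\rho(X,Y)\le\alpha n$; they exchange bits in both directions according to a protocol agreed on in advance, and at the end Bob must know $X$ (always correctly). The communication complexity is the total number of bits sent in both directions in the worst case. A protocol is $r$-round if at most $r$ messages are sent, alternately by the two participants (each message may consist of several bits). A code of length $n$ has rate $R$ if it has $2^{Rn}$ codewords. *)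

(* Defs.v *)
From HB Require Import structures.
From mathcomp Require Import all_boot all_order all_algebra.
From mathcomp Require Import all_classical all_reals all_analysis.
Set Implicit Arguments.
Unset Strict Implicit.
Unset Printing Implicit Defensive.
Import Order.TTheory GRing.Theory Num.Theory.
Import numFieldNormedType.Exports.
Local Open Scope ring_scope.

(** * Words, codes *)

Notation word n := 'rV['F_2]_n.

Definition hamming n (x y : word n) : nat := #|[set i : 'I_n | x 0 i != y 0 i]%SET|.

Definition close (R : realType) (alpha : R) n (x y : word n) : bool :=
  (hamming x y)%:R <= alpha * n%:R.

Definition neighbours (R : realType) (alpha : R) n (C : {set word n}) (y : word n) :
    {set word n} :=
  [set z in C | close alpha y z]%SET.

Definition linear_code n (C : {set word n}) : Prop :=
  0 \in C /\ forall (a : 'F_2) (x y : word n),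
    x \in C -> y \in C -> a *: x + y \in C.

(* The rows of [G] form a basis of [C]. *)
Definition generator_matrix n (C : {set word n}) k (G : 'M['F_2]_(k, n)) : Prop :=
  row_free G /\ forall z : word n, (z \in C) = (z <= G)%MS.

(* [#|C| = 2 ^ (rate * n)], the exponent being rounded to one of its neighbouring
   integers when [rate * n] is not an integer (exact otherwise). *)
Definition has_rate (R : realType) (rate : R) n (C : {set word n}) : Prop :=
  exists2 m : nat, #|C| = (2 ^ m)%N & `|m%:R - rate * n%:R| < 1.

Definition list_decodable (R : realType) (alpha : R) (L : nat) n (C : {set word n}) :
    Prop :=
  forall y : word n, (#|neighbours alpha C y| <= L)%N.

Definition polynomially_bounded (lengths : pred nat) (f : nat -> nat) : Prop :=
  exists p : {poly nat}, forall n, n \in lengths -> (f n <= p.[n])%N.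

(** * Algorithms: uniform-cost RAM programs

   The machine has registers and arrays, all holding natural numbers; every
   executed instruction costs 1.  The only arithmetic operations are addition and
   truncated subtraction: under uniform cost, multiplication of unbounded
   integers would make the model unreasonably powerful. *)

Inductive cmd : Type :=
| Skip
| Const (i v : nat)             (* r_i := v *)
| Move (i j : nat)              (* r_i := r_j *)
| Add (i j l : nat)             (* r_i := r_j + r_l *)
| Sub (i j l : nat)             (* r_i := r_j - r_l *)
| Read (i a j : nat)            (* r_i := a[r_j] *)
| Write (a j i : nat)           (* a[r_j] := r_i *)
| Seq (c1 c2 : cmd)
| IfLt (i j : nat) (c1 c2 : cmd)    (* if r_i < r_j then c1 else c2 *)
| WhileLt (i j : nat) (c : cmd).    (* while r_i < r_j do c *)

Record store : Type := MkStore {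
  reg : nat -> nat;
  arr : nat -> nat -> nat
}.

Definition upd (A : Type) (f : nat -> A) (i : nat) (v : A) : nat -> A :=
  fun j => if j == i then v else f j.

Definition set_reg (s : store) (i v : nat) : store :=
  MkStore (upd (reg s) i v) (arr s).

Definition set_arr (s : store) (a : nat) (f : nat -> nat) : store :=
  MkStore (reg s) (upd (arr s) a f).

(* [exec c s s' t]: started in [s], [c] halts in [s'] after [t] steps. *)
Inductive exec : cmd -> store -> store -> nat -> Prop :=
| ExecSkip s : exec Skip s s 1
| ExecConst s i v : exec (Const i v) s (set_reg s i v) 1
| ExecMove s i j : exec (Move i j) s (set_reg s i (reg s j)) 1
| ExecAdd s i j l : exec (Add i j l) s (set_reg s i (reg s j + reg s l)%N) 1
| ExecSub s i j l : exec (Sub i j l) s (set_reg s i (reg s j - reg s l)%N) 1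
| ExecRead s i a j : exec (Read i a j) s (set_reg s i (arr s a (reg s j))) 1
| ExecWrite s a j i :
    exec (Write a j i) s (set_arr s a (upd (arr s a) (reg s j) (reg s i))) 1
| ExecSeq c1 c2 s s1 s2 t1 t2 :
    exec c1 s s1 t1 -> exec c2 s1 s2 t2 -> exec (Seq c1 c2) s s2 (t1 + t2)%N
| ExecIfTrue i j c1 c2 s s' t :
    (reg s i < reg s j)%N -> exec c1 s s' t -> exec (IfLt i j c1 c2) s s' t.+1
| ExecIfFalse i j c1 c2 s s' t :
    (reg s j <= reg s i)%N -> exec c2 s s' t -> exec (IfLt i j c1 c2) s s' t.+1
| ExecWhileTrue i j c s s1 s2 t1 t2 :
    (reg s i < reg s j)%N -> exec c s s1 t1 -> exec (WhileLt i j c) s1 s2 t2 ->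
    exec (WhileLt i j c) s s2 (t1 + t2).+1
| ExecWhileFalse i j c s :
    (reg s j <= reg s i)%N -> exec (WhileLt i j c) s s 1.

(** Input/output conventions.
   Registers: 0 = length [n], 1 = dimension [k], 2 = size of the last received
   message, 3 = size of the output.
   Arrays: 0 = input word, 1 = generator matrix (row by row), 2 = last received
   message, 3 = output. *)

Definition matrix_array k n (M : 'M['F_2]_(k, n)) : nat -> nat :=
  fun p => [exists i : 'I_k, [exists j : 'I_n,
              (p == i * n + j)%N && (M i j != 0)]] : nat.

Definition input_store k n (G : 'M['F_2]_(k, n)) (w : word n) : store :=
  MkStore (fun i => if i == 0%N then n else if i == 1%N then k else 0%N)
          (fun a => if a == 0%N then matrix_array w
                    else if a == 1%N then matrix_array G else fun=> 0%N).

(* The word of length [n] stored in the output array from position [p] on. *)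
Definition output_word n (p : nat) (s : store) : word n :=
  \row_(j < n) (arr s 3 (p + j)%N != 0%N)%:R.

(* Register 3 counts the words of the list, stored one after the other. *)
Definition output_list n (s : store) : seq (word n) :=
  mkseq (fun i => output_word n (i * n)%N s) (reg s 3).

(* [D] lists, without repetition, the codewords in the ball around [y] in at most
   [T] steps; it is given [n], [y] and the generator matrix of the code. *)
Definition list_decodes (R : realType) (alpha : R) (D : cmd) n (C : {set word n})
    k (G : 'M['F_2]_(k, n)) (T : nat) : Prop :=
  forall y : word n, exists s' : store, exists t : nat,
    [/\ exec D (input_store G y) s' t, (t <= T)%N
      & perm_eq (output_list n s') (enum (neighbours alpha C y))].

(** * Protocols *)

(* [turns] are the programs successively computing the messages; the speakers
   alternate, each of them working in a private memory which persists from one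
   turn to the next.  After the last message Bob runs [final]. *)
Record protocol : Type := Protocol {
  alice_starts : bool;
  turns : seq cmd;
  final : cmd
}.

Definition rounds (r : nat) (P : protocol) : Prop := (size (turns P) <= r)%N.

Definition sent (s : store) : seq bool :=
  mkseq (fun j => arr s 3 j != 0%N) (reg s 3).

Definition receive (m : seq bool) (s : store) : store :=
  set_arr (set_reg s 2 (size m)) 2 (fun j => nth false m j : nat).

(* [session a cs sA sB tr sB' t]: if [a], Alice speaks first, otherwise Bob does;
   from the memories [sA] and [sB], running [cs] yields the messages [tr], leaves
   Bob with memory [sB'] and takes [t] steps in total. *)
Inductive session :
    bool -> seq cmd -> store -> store -> seq (seq bool) -> store -> nat -> Prop :=
| SessionEnd a sA sB : session a [::] sA sB [::] sB 0
| SessionAlice c cs sA sA' sB tr sB' t t' :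
    exec c sA sA' t ->
    session false cs sA' (receive (sent sA') sB) tr sB' t' ->
    session true (c :: cs) sA sB (sent sA' :: tr) sB' (t + t')%N
| SessionBob c cs sA sB sB1 tr sB' t t' :
    exec c sB sB1 t ->
    session true cs (receive (sent sB1) sA) sB1 tr sB' t' ->
    session false (c :: cs) sA sB (sent sB1 :: tr) sB' (t + t')%N.

(* On inputs [x] (Alice) and [y] (Bob), the code being known to both, the messages
   are [tr], Bob's answer is [out], and both parties together use [t] steps. *)
Definition run (P : protocol) n k (G : 'M['F_2]_(k, n)) (x y : word n)
    (tr : seq (seq bool)) (out : word n) (t : nat) : Prop :=
  exists sB : store, exists s : store, exists t1 : nat, exists t2 : nat,
    [/\ session (alice_starts P) (turns P) (input_store G x) (input_store G y) tr sB t1,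
        exec (final P) sB s t2, out = output_word n 0 s & t = (t1 + t2)%N].

(* Whenever the promise holds, the run has messages [tr x y], takes [time x y]
   steps, and Bob ends up with [x]. *)
Definition synchronizes (R : realType) (alpha : R) (P : protocol) n k
    (G : 'M['F_2]_(k, n)) (tr : word n -> word n -> seq (seq bool))
    (time : word n -> word n -> nat) : Prop :=
  forall x y : word n, close alpha x y -> run P G x y (tr x y) x (time x y).

(* After the same first messages, no possible next message is a proper prefix of
   another one: the end of a message carries no information beyond its bits, so
   counting bits is legitimate. *)
Definition self_delimiting (R : realType) (alpha : R) n
    (tr : word n -> word n -> seq (seq bool)) : Prop :=
  forall x y x' y' : word n, close alpha x y -> close alpha x' y' ->
  forall j : nat, take j (tr x y) = take j (tr x' y') ->
    prefix (nth [::] (tr x y) j) (nth [::] (tr x' y') j) ->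
    nth [::] (tr x y) j = nth [::] (tr x' y') j.

Definition worst_case (R : realType) (alpha : R) n (f : word n -> word n -> nat) : nat :=
  \max_(p : word n * word n | close alpha p.1 p.2) f p.1 p.2.

Definition communication n (tr : word n -> word n -> seq (seq bool)) :
    word n -> word n -> nat :=
  fun x y => size (flatten (tr x y)).

(* Main.v *)
Require Import Defs.
From mathcomp Require Import all_boot all_order all_algebra.
From mathcomp Require Import all_classical all_reals all_analysis.
From mathcomp Require Import zify ring.
Import Order.TTheory GRing.Theory Num.Theory.
Import numFieldNormedType.Exports.
Local Open Scope classical_set_scope.
Local Open Scope ring_scope.

                                                                                
                                                                              
                                                                                   
                                                                                   
                                                                               
                                                                  
                                                                                  
                                                                                   
                                                                                 

                                            

(** The protocol is syndrome coding followed by a short disambiguation. The code is linear, so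
    Gaussian elimination on its generator matrix, with [x] appended as a last row, reduces [x] to a
    word [u] that vanishes on the [k] pivot columns and satisfies [x + u] in the code ([elim_last]).
    Alice sends the other [n - k] bits of [u] ([unmarked_count]). The pivot columns depend on the
    generator matrix alone ([marked_augmented]), so Bob can place these bits and form [y + u]. Its
    distance to the codeword [x + u] is that of [y] to [x], hence list decoding [y + u] yields at
    most [L] words, one of them [x + u].

    To single it out, words are read as integers below [2 ^ n]. Bob sends the least modulus [M] for
    which the listed integers have distinct residues, Alice answers with the residue of [x + u], and
    Bob recovers [x + u] and then [x]. Such an [M] exists below [n * l ^ 2 + 2] for a list of length
    [l] ([exists_separating]): otherwise every [m] up to that bound would divide some difference of
    two listed integers, hence the product of all differences, which is at most [2 ^ (n * l ^ 2)],
    whereas a positive common multiple of [1, ..., m] is at least [2 ^ (m - 1)]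
    ([expn_le_common_multiple]).

    As [L] is polynomial, [M] and the residue fit in a fixed width [B = O(log n)] ([exists_width]).
    The messages always have lengths [n - k], [B], [B], so they delimit themselves and the
    communication is exactly [n - k + 2B]; [k] is within 1 of [rate * n], and [B] is [O(sqrt n)] by
    a crude bound ([sq_up_log]).

    Time: elimination is cubic in [n], and the search for [M] costs about [M * l * n], that is
    [O(L^3 n^2)]. The decoder runs unchanged in a disjoint part of memory ([exec_relocate]). The
    programs are verified in a small program logic with step bounds, and [run_spec] assembles the
    turns. *)

Section Logic.
Local Open Scope nat_scope.

(** * A program logic for total correctness with step bounds *)

Fixpoint modr (c : cmd) (r : nat) : bool :=
  match c with
  | Const i _ | Move i _ | Add i _ _ | Defs.Sub i _ _ | Read i _ _ => r == i
  | Seq c1 c2 | IfLt _ _ c1 c2 => modr c1 r || modr c2 r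
  | WhileLt _ _ c => modr c r
  | Skip | Write _ _ _ => false
  end.

Fixpoint moda (c : cmd) (a : nat) : bool :=
  match c with
  | Write b _ _ => a == b
  | Seq c1 c2 | IfLt _ _ c1 c2 => moda c1 a || moda c2 a
  | WhileLt _ _ c => moda c a
  | _ => false
  end.

(** The frame condition, read off the syntax of [c]: it carries facts about untouched memory through
    a program without putting them into every postcondition. *)
Definition unch (c : cmd) (s s' : store) : Prop :=
  (forall r, ~~ modr c r -> reg s' r = reg s r) /\
  (forall a, ~~ moda c a -> arr s' a = arr s a).

Lemma unch_refl c s : unch c s s.
Proof. by []. Qed.

Lemma unch_trans c s1 s2 s3 : unch c s1 s2 -> unch c s2 s3 -> unch c s1 s3.
Proof.
move=> [r1 a1] [r2 a2]; split=> [r|a] h; first by rewrite r2 ?r1.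
by rewrite a2 ?a1.
Qed.

Lemma unch_weaken c c' s s' :
  (forall r, modr c r -> modr c' r) -> (forall a, moda c a -> moda c' a) ->
  unch c s s' -> unch c' s s'.
Proof.
move=> hr ha [ur ua]; split=> [r|a] h.
  by apply: ur; apply: contra h; apply: hr.
by apply: ua; apply: contra h; apply: ha.
Qed.

Lemma exec_unch c s s' t : exec c s s' t -> unch c s s'.
Proof.
elim=> {c s s' t} //=.
- by move=> s i v; split=> //= r; rewrite /upd; case: (r == i).
- by move=> s i j; split=> //= r; rewrite /upd; case: (r == i).
- by move=> s i j l; split=> //= r; rewrite /upd; case: (r == i).
- by move=> s i j l; split=> //= r; rewrite /upd; case: (r == i).
- by move=> s i a j; split=> //= r; rewrite /upd; case: (r == i).
- by move=> s a j i; split=> //= r; rewrite /upd; case: (r == a).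
- move=> c1 c2 s s1 s2 t1 t2 _ u1 _ u2; apply: (@unch_trans _ _ s1).
    by apply: unch_weaken u1 => r /= ->.
  by apply: unch_weaken u2 => r /= ->; rewrite orbT.
- by move=> i j c1 c2 s s' t _ _; apply: unch_weaken => r /= ->.
- by move=> i j c1 c2 s s' t _ _; apply: unch_weaken => r /= ->; rewrite orbT.
- by move=> i j c s s1 s2 t1 t2 _ _ u1 _ u2; apply: unch_trans u1 u2.
Qed.

(** Total correctness: some execution halts within [T] steps in a store satisfying [Q]. *)
Definition wp (c : cmd) (s : store) (T : nat) (Q : store -> Prop) : Prop :=
  exists s' t, [/\ exec c s s' t, t <= T & Q s'].

Lemma wp_conseq c s T T' (Q Q' : store -> Prop) :
  wp c s T Q -> T <= T' -> (forall s', unch c s s' -> Q s' -> Q' s') -> wp c s T' Q'.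
Proof.
move=> [s' [t [e le q]]] leT h; exists s', t; split=> //; first exact: leq_trans leT.
exact: h (exec_unch _ _ _ _ e) q.
Qed.

Lemma wp_seq T1 T2 Q1 c1 c2 s T Q :
  wp c1 s T1 Q1 -> (forall s1, unch c1 s s1 -> Q1 s1 -> wp c2 s1 T2 Q) ->
  T1 + T2 <= T -> wp (Seq c1 c2) s T Q.
Proof.
move=> [s1 [t1 [e1 l1 q1]]] h leT.
have [s2 [t2 [e2 l2 q2]]] := h _ (exec_unch _ _ _ _ e1) q1.
exists s2, (t1 + t2); split=> //; first exact: ExecSeq e1 e2.
by apply: leq_trans leT; apply: leq_add.
Qed.

Fixpoint loopfree (c : cmd) : bool :=
  match c with
  | Seq c1 c2 | IfLt _ _ c1 c2 => loopfree c1 && loopfree c2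
  | WhileLt _ _ _ => false
  | _ => true
  end.

Fixpoint ev (c : cmd) (s : store) : store :=
  match c with
  | Skip => s
  | Const i v => set_reg s i v
  | Move i j => set_reg s i (reg s j)
  | Add i j l => set_reg s i (reg s j + reg s l)
  | Defs.Sub i j l => set_reg s i (reg s j - reg s l)
  | Read i a j => set_reg s i (arr s a (reg s j))
  | Write a j i => set_arr s a (upd (arr s a) (reg s j) (reg s i))
  | Seq c1 c2 => ev c2 (ev c1 s)
  | IfLt i j c1 c2 => if reg s i < reg s j then ev c1 s else ev c2 s
  | WhileLt _ _ _ => s
  end.

Fixpoint cost (c : cmd) : nat :=
  match c with
  | Seq c1 c2 => cost c1 + cost c2
  | IfLt _ _ c1 c2 => (cost c1 + cost c2).+1
  | _ => 1
  end.

Lemma wp_ev c s T (Q : store -> Prop) :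
  loopfree c -> cost c <= T -> Q (ev c s) -> wp c s T Q.
Proof.
move=> lf leT q; suff [t [e l]] : exists t, exec c s (ev c s) t /\ t <= cost c.
  by exists (ev c s), t; split=> //; apply: leq_trans leT.
elim: c s lf {Q T leT q}.
- by move=> s _; exists 1; split=> //; apply: ExecSkip.
- by move=> i v s _; exists 1; split=> //; apply: ExecConst.
- by move=> i v s _; exists 1; split=> //; apply: ExecMove.
- by move=> i v l s _; exists 1; split=> //; apply: ExecAdd.
- by move=> i v l s _; exists 1; split=> //; apply: ExecSub.
- by move=> i v l s _; exists 1; split=> //; apply: ExecRead.
- by move=> i v l s _; exists 1; split=> //; apply: ExecWrite.
- move=> c1 h1 c2 h2 s /= /andP[/(h1 s)[t1 [e1 l1]] /(h2 (ev c1 s))[t2 [e2 l2]]].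
  by exists (t1 + t2); split; [apply: ExecSeq e1 e2 | apply: leq_add].
- move=> i j c1 h1 c2 h2 s /= /andP[/(h1 s)[t1 [e1 l1]] /(h2 s)[t2 [e2 l2]]].
  case: ltnP => h.
    by exists t1.+1; split; [apply: ExecIfTrue | rewrite ltnS (leq_trans l1) ?leq_addr].
  by exists t2.+1; split; [apply: ExecIfFalse | rewrite ltnS (leq_trans l2) ?leq_addl].
- by [].
Qed.

Lemma wp_if i j c1 c2 s T T' Q :
  (reg s i < reg s j -> wp c1 s T Q) -> (reg s j <= reg s i -> wp c2 s T Q) ->
  T < T' -> wp (IfLt i j c1 c2) s T' Q.
Proof.
move=> h1 h2 leT; case: (ltnP (reg s i) (reg s j)) => h.
  have [s' [t [e l q]]] := h1 h.
  by exists s', t.+1; split=> //; [apply: ExecIfTrue|apply: leq_ltn_trans l leT].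
have [s' [t [e l q]]] := h2 h.
by exists s', t.+1; split=> //; [apply: ExecIfFalse|apply: leq_ltn_trans l leT].
Qed.

(** The invariant is indexed by the number of completed iterations, which is exactly [N] in total.
    Each iteration pays one step for its test; the strict bound on [T] pays for the last, failing
    test. *)
Lemma wp_while N Tb (I : nat -> store -> Prop) i j c s T (Q : store -> Prop) :
  I 0 s ->
  (forall m s', m < N -> unch c s s' -> I m s' ->
     reg s' i < reg s' j /\ wp c s' Tb (I m.+1)) ->
  (forall s', unch c s s' -> I N s' -> reg s' j <= reg s' i /\ Q s') ->
  N * Tb.+1 < T -> wp (WhileLt i j c) s T Q.
Proof.
move=> I0 step fin leT; rewrite -(subn0 N) in leT.
have: 0 <= N by [].
move: I0 leT (unch_refl c s); move: {1 3 4}s => s0; move: {1 2 3}0 => m.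
move Ed: (N - m) => d; elim: d => [|d IH] in m s0 T Ed *.
  move=> Im leT U lm.
  have Em : m = N by lia.
  subst m; have [h q] := fin _ U Im.
  by exists s0, 1; split; [apply: ExecWhileFalse | lia |].
move=> Im leT U lm; have lt : m < N by lia.
have [h [s1 [t1 [e1 l1 I1]]]] := step _ _ lt U Im.
have [s2 [t2 [e2 l2 q2]]] : wp (WhileLt i j c) s1 (T - t1.+1) Q.
  apply: (IH m.+1) => //; try lia.
  exact: unch_trans U (exec_unch _ _ _ _ e1).
exists s2, (t1 + t2).+1; split; [exact: ExecWhileTrue h e1 e2 | lia | by []].
Qed.

                                      
(** Counted loop. The increment adds register 5, which holds the constant 1 throughout. *)
Definition For (i j : nat) (c : cmd) : cmd :=
  Seq (Const i 0) (WhileLt i j (Seq c (Add i i 5))).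

Lemma wp_for N Tb (I : nat -> store -> Prop) i j c s T (Q : store -> Prop) :
  [&& ~~ modr c i, ~~ modr c j, ~~ modr c 5, i != j & i != 5] ->
  reg s 5 = 1 -> reg s j = N ->
  I 0 (set_reg s i 0) ->
  (forall m s', m < N -> unch (For i j c) s s' -> reg s' i = m -> I m s' ->
     wp c s' Tb (fun s'' => I m.+1 (set_reg s'' i m.+1))) ->
  (forall s', unch (For i j c) s s' -> reg s' i = N -> I N s' -> Q s') ->
  N * Tb.+2 + 2 <= T -> wp (For i j c) s T Q.
Proof.
move=> /and5P[mi mj m5 nij ni5] s5 sj I0 step fin leT.
have nj : j != i by rewrite eq_sym.
have n5 : 5 != i by rewrite eq_sym.
have UF s' : unch (Seq c (Add i i 5)) (set_reg s i 0) s' -> unch (For i j c) s s'.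
  move=> [ur ua]; split=> [r|a] /= h; last by rewrite ua.
  rewrite ur /= /upd; last by apply: contra h => ->; rewrite orbT.
  by case: eqP h => // _.
apply: (@wp_seq 1 (N * Tb.+2).+1 (fun s' => s' = set_reg s i 0)).
- exact: wp_ev.
- move=> s1 _ ->.
  apply: (@wp_while N Tb.+1 (fun m s' => reg s' i = m /\ I m s')) => //.
  + by split=> //=; rewrite /upd eqxx.
  + move=> m s' lt U [ri Im].
    have U' := UF _ U.
    have rj : reg s' j = N.
      by rewrite U.1 /= /upd ?(negPf nj) // negb_or mj.
    have r5 : reg s' 5 = 1.
      by rewrite U.1 /= /upd ?(negPf n5) // negb_or m5.
    split; first by rewrite ri rj.
    apply: (@wp_seq Tb 1 (fun s'' => I m.+1 (set_reg s'' i m.+1))).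
    * exact: step.
    * move=> s2 U2 I2; apply: wp_ev => //=.
      rewrite !U2.1 // ri r5 addn1; split=> //=; first by rewrite /upd eqxx.
    * by rewrite addn1.
  + move=> s' U [ri IN]; have U' := UF _ U.
    split; last exact: fin.
    have rj : reg s' j = N.
      by rewrite U.1 /= /upd ?(negPf nj) // negb_or mj.
    by rewrite ri rj.
- by lia.
Qed.

End Logic.

                             

(** * Gaussian elimination as a function on Boolean arrays *)

Section Elimination.
Local Open Scope nat_scope.

(** Pivots are the last nonzero columns: a forward scan that overwrites its answer at each nonzero
    entry finds them. The default 0 stands for a zero row, which independence of the rows
    excludes. *)
Fixpoint lastnz (v : nat -> bool) (j : nat) : nat :=
  if j is j'.+1 then (if v j' then j' else lastnz v j') else 0.

(** Only rows after [i] are cleared in the pivot column of row [i]; this echelon form is enough to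
    reduce the last row. *)
Definition elim_step n (A : nat -> nat -> bool) (i : nat) : nat -> nat -> bool :=
  fun r j =>
    if (i < r) && A r (lastnz (A i) n) then A r j (+) A i j else A r j.

Fixpoint elim n (A : nat -> nat -> bool) (i : nat) : nat -> nat -> bool :=
  if i is i'.+1 then elim_step n (elim n A i') i' else A.

Definition pivot n A i := lastnz (elim n A i i) n.

Definition marked n A i j := has (fun i' => pivot n A i' == j) (iota 0 i).

Lemma markedS n A i j : marked n A i.+1 j = marked n A i j || (pivot n A i == j).
Proof. by rewrite /marked -[i.+1]addn1 iotaD has_cat /= orbF. Qed.

Lemma lastnz_lt (v : nat -> bool) n : 0 < n -> lastnz v n < n.
Proof.
elim: n => [//|[|n] IH] _; rewrite [lastnz _ _]/=; case: ifP => // _.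
exact: leqW (IH isT).
Qed.

Lemma lastnzP (v : nat -> bool) n j : j < n -> v j -> v (lastnz v n).
Proof.
elim: n => //= n IH; rewrite ltnS leq_eqVlt => /orP[/eqP-> vn|lt vj].
  by rewrite vn.
by case E: (v n) => //; apply: IH.
Qed.

Lemma offset_inj n i j i' j' : j < n -> j' < n ->
  (i * n + j == i' * n + j') = (i == i') && (j == j').
Proof.
move=> lj lj'; apply/eqP/andP => [E|[/eqP-> /eqP->]] //.
have n0 : 0 < n by apply: leq_trans lj.
have Ei := congr1 (divn^~ n) E; have Ej := congr1 (modn^~ n) E.
rewrite /= !divnMDl // !divn_small // !addn0 in Ei.
by rewrite /= !modnMDl !modn_small // in Ej; rewrite Ei Ej.
Qed.

End Elimination.

(** * The elimination program and its cubic running time *)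

Section EliminationProgram.
Local Open Scope nat_scope.

                                                                                 
                                                
(** Memory layout of the turns: register 4 is 0, register 5 is 1, register 6 is [k * n], where the
    row appended below the matrix starts, and register 7 is [k.+1 * n], where it ends. Products are
    computed by repeated addition. *)
Definition init_prog : cmd :=
  Seq (Const 5 1) (Seq (Const 6 0) (Seq (For 8 1 (Add 6 6 0)) (Add 7 6 0))).

Definition append_prog : cmd :=
  For 8 0 (Seq (Read 13 0 8) (Seq (Add 14 6 8) (Write 1 14 13))).

Definition row_xor_prog : cmd :=
  For 9 0 (Seq (Add 13 10 9) (Seq (Read 15 1 13)
    (IfLt 4 15 (Seq (Add 16 11 9) (Seq (Read 17 1 16)
       (Seq (Defs.Sub 17 5 17) (Write 1 16 17)))) Skip))).

Definition pivot_prog : cmd :=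
  Seq (Const 12 0)
   (For 9 0 (Seq (Add 13 10 9) (Seq (Read 14 1 13) (IfLt 4 14 (Move 12 9) Skip)))).

Definition elim_row_prog : cmd :=
  Seq (Add 13 11 12) (Seq (Read 14 1 13)
    (Seq (IfLt 4 14 row_xor_prog Skip) (Add 11 11 0))).

(** Registers 10 and 11 hold row offsets, multiples of [n], instead of row indices, which avoids
    multiplication. Array 5 marks the pivot columns. *)
Definition elim_prog : cmd :=
  Seq (Const 10 0) (WhileLt 10 6
    (Seq pivot_prog (Seq (Write 5 12 5) (Seq (Add 11 10 0)
      (Seq (WhileLt 11 7 elim_row_prog) (Add 10 10 0)))))).

Lemma init_spec n k s : k <= n -> 0 < n -> reg s 0 = n -> reg s 1 = k ->
  wp init_prog s (10 * n) (fun s' => [/\ reg s' 5 = 1, reg s' 6 = k * n & reg s' 7 = k.+1 * n]).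
Proof.
move=> kn n0 s0 s1.
apply: (@wp_seq 1 (9 * n) (fun s' => reg s' 5 = 1)) => [||]; [exact: wp_ev | | lia].
move=> s' U' r5.
apply: (@wp_seq 1 (8 * n) (fun s' => reg s' 6 = 0)) => [||]; [exact: wp_ev | | lia].
move=> s'' U'' r6.
apply: (@wp_seq (6 * n) 1 (fun s' => reg s' 6 = k * n)) => [||]; last by lia.
  apply: (@wp_for k 1 (fun m s => reg s 6 = m * n)) => //.
  - by rewrite (U''.1 5).
  - by rewrite (U''.1 1 isT) (U'.1 1 isT).
  - move=> m t lt U r8 Im; apply: wp_ev => //=.
    by rewrite /upd /= Im (U.1 0 isT) (U''.1 0 isT) (U'.1 0 isT) s0 mulSn addnC.
  - lia.
move=> t U r; apply: wp_ev => //=; rewrite /upd /=.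
by rewrite (U.1 5 isT) (U''.1 5 isT) (U.1 0 isT) (U''.1 0 isT) (U'.1 0 isT) r s0 mulSn addnC.
Qed.

Definition mat n k (s : store) (A : nat -> nat -> bool) : Prop :=
  forall i j, i <= k -> j < n -> arr s 1 (i * n + j) = A i j :> nat.

Lemma append_spec n k s (A : nat -> nat -> bool) (w : nat -> bool) :
  reg s 0 = n -> reg s 5 = 1 -> reg s 6 = k * n ->
  (forall j, j < n -> arr s 0 j = w j :> nat) ->
  (forall i j, i < k -> j < n -> arr s 1 (i * n + j) = A i j :> nat) ->
  wp append_prog s (5 * n + 2)
    (fun s' => mat n k s' (fun i j => if i < k then A i j else w j)).
Proof.
move=> s0 s5 s6 sw sA.
apply: (@wp_for n 3 (fun m s => forall i j, (i < k) || (i == k) && (j < m) -> j < n ->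
  arr s 1 (i * n + j) = (if i < k then A i j else w j) :> nat)) => //; last by lia.
- by move=> i j; rewrite andbF orbF => lt ltj; rewrite lt sA.
- move=> m t lt U r8 Im; apply: wp_ev => //= i j h ltj.
  rewrite /upd /= r8 (U.1 6 isT) s6 offset_inj // (U.2 0 isT) sw //.
  case: (ltngtP i k) h => [lt' _|//|->] /=.
  - by rewrite Im // ?lt'.
  - rewrite ltnS leq_eqVlt; case: eqP => [->//|_ /= ltj'].
    by rewrite Im // ?ltnn ?eqxx.
- move=> s' U r8 In i j; rewrite leq_eqVlt => h ltj; apply: In => //.
  by case/orP: h => ->; rewrite ?ltj ?orbT.
Qed.

Lemma row_xor_spec n k s A i i2 :
  reg s 0 = n -> reg s 4 = 0 -> reg s 5 = 1 -> reg s 10 = i * n -> reg s 11 = i2 * n ->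
  i <= k -> i2 <= k -> i != i2 -> mat n k s A ->
  wp row_xor_prog s (10 * n + 2)
    (fun s' => mat n k s' (fun r j => if r == i2 then A r j (+) A i j else A r j)).
Proof.
move=> s0 s4 s5 s10 s11 ik i2k ni sA.
apply: (@wp_for n 8 (fun m s => mat n k s
  (fun r j => if (r == i2) && (j < m) then A r j (+) A i j else A r j))) => //; last by lia.
- by move=> r j lr lj; rewrite andbF; apply: sA.
- move=> m t lt U r9 Im; apply: wp_ev => //= r j lr lj.
  have Ei : arr t 1 (i * n + m) = A i m by rewrite Im // (negPf ni).
  have Ei2 : arr t 1 (i2 * n + m) = A i2 m by rewrite Im // ltnn andbF.
  rewrite /upd /= r9 (U.1 10 isT) (U.1 4 isT) (U.1 5 isT) s10 s4 s5 (U.1 11 isT) s11 Ei.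
  case Aim: (A i m); rewrite /= /upd /= ?(U.1 11 isT) ?s11 ?Ei2 ?offset_inj //.
    case: (r =P i2) => [->|/eqP nr] /=; last by rewrite Im // (negPf nr).
    case: (j =P m) => [->|/eqP nj] /=; first by rewrite ltnSn Aim; case: (A i2 m).
    by rewrite Im // eqxx ltnS (leq_eqVlt j) (negPf nj).
  rewrite Im //; case: (r =P i2) => [->|//] /=.
  by case: (ltngtP j m) => h; rewrite ltnS leq_eqVlt ?h ?ltnn ?eqxx ?orbT //=
    ?(gtn_eqF h) ?(ltnNge j) ?(ltnW h) //= Aim addbF.
- move=> s' U r9 In r j lr lj; rewrite In // lj andbT; by [].
Qed.

Lemma pivot_spec n k s A i :
  reg s 0 = n -> reg s 4 = 0 -> reg s 5 = 1 -> reg s 10 = i * n -> i <= k ->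
  mat n k s A ->
  wp pivot_prog s (7 * n + 3) (fun s' => reg s' 12 = lastnz (A i) n).
Proof.
move=> s0 s4 s5 s10 ik sA.
apply: (@wp_seq 1 (7 * n + 2) (fun s' => reg s' 12 = 0)) => [||]; [exact: wp_ev | | lia].
move=> s1 U1 r12.
apply: (@wp_for n 5 (fun m s => reg s 12 = lastnz (A i) m)) => //; last by lia.
- by rewrite (U1.1 5 isT).
- by rewrite (U1.1 0 isT).
- move=> m t lt U r9 Im; apply: wp_ev => //=.
  rewrite /upd /= r9 (U.1 10 isT) (U1.1 10 isT) (U.1 4 isT) (U1.1 4 isT) s10 s4.
  rewrite (U.2 1 isT) (U1.2 1 isT) sA //.
  by case: (A i m) => /=.
Qed.

Lemma elim_row_spec n k s B i m :
  reg s 0 = n -> reg s 4 = 0 -> reg s 5 = 1 -> reg s 10 = i * n ->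
  reg s 11 = m * n -> reg s 12 = lastnz (B i) n -> 0 < n ->
  i < m -> m <= k ->
  mat n k s (fun r j => if r < m then elim_step n B i r j else B r j) ->
  wp elim_row_prog s (10 * n + 6) (fun s' => reg s' 11 = m.+1 * n /\
    mat n k s' (fun r j => if r < m.+1 then elim_step n B i r j else B r j)).
Proof.
move=> s0 s4 s5 s10 s11 s12 n0 im mk sB.
apply: (@wp_seq 1 (10 * n + 5) (fun s' => reg s' 13 = m * n + lastnz (B i) n)) => [||];
  [| |lia].
  by apply: wp_ev => //=; rewrite /upd /= s11 s12.
move=> s1 U1 r13.
apply: (@wp_seq 1 (10 * n + 4) (fun s' => reg s' 14 = B m (lastnz (B i) n))) => [||];
  [| |lia].
  apply: wp_ev => //=; rewrite /upd /= r13 (U1.2 1 isT) sB ?lastnz_lt //.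
  by rewrite ltnn.
move=> s2 U2 r14.
apply: (@wp_seq (10 * n + 3) 1 (fun s' =>
    mat n k s' (fun r j => if r < m.+1 then elim_step n B i r j else B r j))) => [||];
  [| |lia].
  apply: (@wp_if _ _ _ _ _ (10 * n + 2)); last by lia.
    rewrite r14 (U2.1 4 isT) (U1.1 4 isT) s4 => pos.
    have Bm : B m (lastnz (B i) n) by case: (B m _) pos.
    apply: wp_conseq.
    - apply: (@row_xor_spec n k _
        (fun r j => if r < m then elim_step n B i r j else B r j) i m).
      + by rewrite (U2.1 0 isT) (U1.1 0 isT).
      + by rewrite (U2.1 4 isT) (U1.1 4 isT).
      + by rewrite (U2.1 5 isT) (U1.1 5 isT).
      + by rewrite (U2.1 10 isT) (U1.1 10 isT).
      + by rewrite (U2.1 11 isT) (U1.1 11 isT).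
      + by lia.
      + by [].
      + by rewrite neq_ltn im.
      + by move=> r j lr lj; rewrite (U2.2 1 isT) (U1.2 1 isT) sB.
    - by [].
    - move=> s3 U3 M r j lr lj; rewrite M // im ltnS.
      case: (ltngtP r m) => [h|h|->] //=.
      by rewrite /elim_step im Bm ltnn.
  rewrite r14 (U2.1 4 isT) (U1.1 4 isT) s4 => nB.
  have Bm : B m (lastnz (B i) n) = false by case: (B m _) nB.
  apply: wp_ev => //= [|r j lr lj]; first lia.
  rewrite (U2.2 1 isT) (U1.2 1 isT) sB // ltnS.
  case: (ltngtP r m) => [h|h|->] //=.
  by rewrite /elim_step Bm andbF.
move=> s3 U3 M; apply: wp_ev => //=; split=> //.
rewrite /upd /= (U3.1 11 isT) (U2.1 11 isT) (U1.1 11 isT) s11 mulSn addnC.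
by rewrite (U3.1 0 isT) (U2.1 0 isT) (U1.1 0 isT) s0.
Qed.

Lemma elim_spec n k s A :
  0 < n -> k <= n -> reg s 0 = n -> reg s 4 = 0 -> reg s 5 = 1 ->
  reg s 6 = k * n -> reg s 7 = k.+1 * n ->
  mat n k s A -> (forall j, arr s 5 j = 0) ->
  wp elim_prog s (50 * n ^ 3) (fun s' => mat n k s' (elim n A k) /\
    forall j, arr s' 5 j = marked n A k j :> nat).
Proof.
move=> n0 kn s0 s4 s5 s6 s7 sA sm.
apply: (@wp_seq 1 (49 * n ^ 3) (fun s' => reg s' 10 = 0)) => [||]; [exact: wp_ev | |].
  2: by have : 0 < n ^ 3 by [rewrite expn_gt0 n0]; lia.
move=> s1 U1 r10.
apply: (@wp_while k (24 * n ^ 2 + 23) (fun m s => [/\ reg s 10 = m * n,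
   mat n k s (elim n A m) & forall j, arr s 5 j = marked n A m j :> nat])).
- split=> // [i j li lj|j]; first by rewrite (U1.2 1 isT) sA.
  by rewrite (U1.2 5 isT) sm.
- move=> m t lt U [t10 tA tm].
  have t0 : reg t 0 = n by rewrite (U.1 0 isT) (U1.1 0 isT).
  have t4 : reg t 4 = 0 by rewrite (U.1 4 isT) (U1.1 4 isT).
  have t5 : reg t 5 = 1 by rewrite (U.1 5 isT) (U1.1 5 isT).
  have t6 : reg t 6 = k * n by rewrite (U.1 6 isT) (U1.1 6 isT).
  have t7 : reg t 7 = k.+1 * n by rewrite (U.1 7 isT) (U1.1 7 isT).
  split; first by rewrite t10 t6 ltn_pmul2r.
  apply: (@wp_seq (7 * n + 3) (24 * n ^ 2 + 20 - 7 * n)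
     (fun s' => reg s' 12 = pivot n A m)) => [||]; last by nia.
    exact: (@pivot_spec n k _ (elim n A m) m _ _ _ _ (ltnW lt)).
  move=> s2 U2 r12.
  apply: (@wp_seq 1 (24 * n ^ 2 + 19 - 7 * n)
     (fun s' => forall j, arr s' 5 j = marked n A m.+1 j :> nat)) => [||]; last by nia.
    apply: wp_ev => //= j; rewrite /upd /= r12 (U2.2 5 isT) (U2.1 5 isT) t5 tm.
    rewrite markedS [pivot _ _ _ == _]eq_sym.
    by case: (j == _); rewrite ?orbT ?orbF.
  move=> s3 U3 m3.
  apply: (@wp_seq 1 (24 * n ^ 2 + 18 - 7 * n)
     (fun s' => reg s' 11 = m.+1 * n)) => [||]; last by nia.
    apply: wp_ev => //=; rewrite /upd /= (U3.1 10 isT) (U2.1 10 isT) t10.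
    by rewrite (U3.1 0 isT) (U2.1 0 isT) t0 mulSn addnC.
  move=> s4' U4 r11.
  apply: (@wp_seq (24 * n ^ 2 + 17 - 7 * n) 1
     (fun s' => mat n k s' (elim n A m.+1))) => [||]; last by nia.
    have f0 : reg s4' 0 = n by rewrite (U4.1 0 isT) (U3.1 0 isT) (U2.1 0 isT).
    have f4 : reg s4' 4 = 0 by rewrite (U4.1 4 isT) (U3.1 4 isT) (U2.1 4 isT).
    have f5 : reg s4' 5 = 1 by rewrite (U4.1 5 isT) (U3.1 5 isT) (U2.1 5 isT).
    have f7 : reg s4' 7 = k.+1 * n by rewrite (U4.1 7 isT) (U3.1 7 isT) (U2.1 7 isT).
    have f10 : reg s4' 10 = m * n by rewrite (U4.1 10 isT) (U3.1 10 isT) (U2.1 10 isT).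
    have f12 : reg s4' 12 = pivot n A m by rewrite (U4.1 12 isT) (U3.1 12 isT).
    have fA : arr s4' 1 = arr t 1 by rewrite (U4.2 1 isT) (U3.2 1 isT) (U2.2 1 isT).
    (* The rows [m+1, ..., k] are updated; row [k] is the appended word, so there are [k - m] of
       them. *)
    apply: (@wp_while (k - m) (10 * n + 6) (fun q s => reg s 11 = (m.+1 + q) * n /\
       mat n k s (fun r j => if r < m.+1 + q then elim n A m.+1 r j else elim n A m r j))).
    + rewrite addn0; split=> // i j li lj; rewrite fA tA //.
      rewrite ltnS; case: leqP => //= im.
      by rewrite /elim_step ltnNge im.
    + move=> q u lq Uu [u11 uA]; split.
        by rewrite u11 (Uu.1 7 isT) f7 ltn_pmul2r; lia.
      apply: (wp_conseq _ _ _ _ _ _ (elim_row_spec n k u (elim n A m) m (m.+1 + q)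
                 _ _ _ _ u11 _ n0 _ _ uA)) => //; try lia.
      * by rewrite (Uu.1 0 isT).
      * by rewrite (Uu.1 4 isT).
      * by rewrite (Uu.1 5 isT).
      * by rewrite (Uu.1 10 isT) f10.
      * by rewrite (Uu.1 12 isT) f12.
      * by move=> u' _; rewrite -addnS.
    + move=> u Uu [u11 uA]; split.
        rewrite u11 (Uu.1 7 isT) f7 leq_pmul2r //; lia.
      move=> i j li lj; rewrite uA //; case: ltnP => //; lia.
    + nia.
  move=> s5' U5 M; apply: wp_ev => //=; split=> //.
    rewrite /upd /= (U5.1 10 isT) (U4.1 10 isT) (U3.1 10 isT) (U2.1 10 isT) t10.
    by rewrite (U5.1 0 isT) (U4.1 0 isT) (U3.1 0 isT) (U2.1 0 isT) t0 mulSn addnC.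
  by move=> j; rewrite (U5.2 5 isT) (U4.2 5 isT) m3.
- move=> s' U [r M mk]; split=> //.
  by rewrite r (U.1 6 isT) (U1.1 6 isT) s6.
- rewrite !expnS expn0 muln1; nia.
Qed.

End EliminationProgram.

(** * Words as integers, most significant bit first *)

Section Binary.
Local Open Scope nat_scope.

Fixpoint binval (f : nat -> bool) (t : nat) : nat :=
  if t is t'.+1 then (binval f t').*2 + f t' else 0.

Lemma eq_binval (f g : nat -> bool) t :
  (forall j, j < t -> f j = g j) -> binval f t = binval g t.
Proof.
elim: t => //= t IH h; rewrite h // IH // => j lj.
by apply: h; apply: ltnW.
Qed.

Lemma binval_lt f t : binval f t < 2 ^ t.
Proof. by elim: t => //= t IH; rewrite expnS; case: (f t); lia. Qed.

Lemma binval_inj (f g : nat -> bool) t :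
  binval f t = binval g t -> forall j, j < t -> f j = g j.
Proof.
elim: t => //= t IH h j; rewrite ltnS leq_eqVlt => /orP[/eqP->|lt].
  by case: (f t) (g t) h => [] []; lia.
by apply: IH lt; case: (f t) (g t) h => [] []; lia.
Qed.

(** One Horner step modulo [m]: since [2r + b < 2m] when [r < m], one conditional subtraction
    replaces the division that the machine does not have. *)
Lemma modn_double_add m a (b : bool) : 0 < m ->
  (a.*2 + b) %% m = (if (a %% m).*2 + b < m then (a %% m).*2 + b
                     else (a %% m).*2 + b - m).
Proof.
move=> m0; have lt := ltn_pmod a m0.
have -> : (a.*2 + b) %% m = ((a %% m).*2 + b) %% m.
  by rewrite -modnDml -!muln2 -modnMml modnDml.
case: ltnP => h; first by rewrite modn_small.
by rewrite -{1}(subnK h) modnDr modn_small //; case: b h; lia.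
Qed.

End Binary.

(** * The remaining building blocks of the turns *)

Section Programs.
Local Open Scope nat_scope.

(** The rank of column [t] among the non-pivot columns, hence the position of its bit in the first
    message. *)
Definition unmarked_before (mk : nat -> bool) (t : nat) : nat :=
  count (fun j => ~~ mk j) (iota 0 t).

Lemma unmarked_beforeS mk t :
  unmarked_before mk t.+1 = unmarked_before mk t + ~~ mk t.
Proof. by rewrite /unmarked_before -addn1 iotaD count_cat /= addn0. Qed.

Lemma unmarked_before_lt mk j n : j < n -> ~~ mk j ->
  unmarked_before mk j < unmarked_before mk n.
Proof.
elim: n => // n IH; rewrite ltnS leq_eqVlt unmarked_beforeS => /orP[/eqP-> ->|lt mj].
  by rewrite addn1.
by apply: leq_trans (IH lt mj) _; apply: leq_addr.
Qed.

Definition emit_prog : cmd :=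
  Seq (Const 3 0) (For 9 0 (Seq (Read 13 5 9) (IfLt 4 13 Skip
    (Seq (Add 14 6 9) (Seq (Read 15 1 14) (Seq (Write 3 3 15) (Add 3 3 5))))))).

Definition copy_prog : cmd := For 8 6 (Seq (Read 13 1 8) (Write 17 8 13)).

(** Spreads the received bits over the non-pivot columns, giving [u] in array 6, and puts [y + u] in
    array 16, where the relocated decoder looks for its input. *)
Definition shift_word_prog : cmd :=
  Seq (Const 18 0) (For 9 0 (Seq (Read 14 0 9) (Seq (Read 13 5 9)
    (Seq (IfLt 4 13 Skip
       (Seq (Read 15 2 18) (Seq (Write 6 9 15) (Seq (Add 18 18 5)
          (IfLt 4 15 (Defs.Sub 14 5 14) Skip)))))
      (Write 16 9 14))))).

Definition hash_prog (a : nat) : cmd :=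
  Seq (Const 21 0) (For 9 0 (Seq (Add 13 22 9) (Seq (Read 14 a 13)
    (Seq (Add 21 21 21) (Seq (IfLt 4 14 (Add 21 21 5) Skip)
      (IfLt 21 20 Skip (Defs.Sub 21 21 20))))))).

Definition sum_prog : cmd :=
  For 9 0 (Seq (Read 13 0 9) (Seq (Add 14 6 9) (Seq (Read 15 1 14)
    (Seq (IfLt 4 15 (Defs.Sub 13 5 13) Skip) (Write 6 9 13))))).

Definition output_prog : cmd :=
  For 9 0 (Seq (Add 13 22 9) (Seq (Read 14 19 13) (Seq (Read 15 6 9)
    (Seq (IfLt 4 14 (Defs.Sub 15 5 15) Skip) (Write 3 9 15))))).

(** Doubling register 32 up to at least [n + 1] counts the rounded-up logarithm; register 30 grows
    by [e] each time, and register 31 becomes 2 to that power. *)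
Definition width_prog (e : nat) : cmd :=
  Seq (Const 30 0) (Seq (Const 33 e) (Seq (Const 32 1) (Seq (Add 34 0 5)
   (Seq (WhileLt 32 34 (Seq (Add 32 32 32) (Add 30 30 33)))
    (Seq (Const 31 1) (For 9 30 (Add 31 31 31))))))).

Definition encode_prog : cmd :=
  Seq (For 9 30 (Seq (Add 35 35 35)
    (IfLt 35 31 (Write 3 9 4) (Seq (Defs.Sub 35 35 31) (Write 3 9 5)))))
    (Move 3 30).

Definition decode_prog : cmd :=
  Seq (Const 36 0) (For 9 2 (Seq (Add 36 36 36) (Seq (Read 13 2 9) (Add 36 36 13)))).

Lemma emit_spec n k s (mk v : nat -> bool) :
  0 < n -> reg s 0 = n -> reg s 4 = 0 -> reg s 5 = 1 -> reg s 6 = k * n ->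
  (forall j, j < n -> arr s 5 j = mk j :> nat) ->
  (forall j, j < n -> arr s 1 (k * n + j) = v j :> nat) ->
  wp emit_prog s (14 * n) (fun s' => reg s' 3 = unmarked_before mk n /\
    forall j, j < n -> ~~ mk j -> arr s' 3 (unmarked_before mk j) = v j :> nat).
Proof.
move=> n0 s0 s4 s5 s6 sm sv.
apply: (@wp_seq 1 (13 * n) (fun s' => reg s' 3 = 0)) => [||]; [exact: wp_ev | | lia].
move=> s1 U1 r3.
apply: (@wp_for n 7 (fun t s => reg s 3 = unmarked_before mk t /\
    forall j, j < t -> ~~ mk j -> arr s 3 (unmarked_before mk j) = v j :> nat)) => //.
- by rewrite (U1.1 5 isT).
- by rewrite (U1.1 0 isT).
- move=> m t lt U t9 [t3 tv]; apply: wp_ev => //=.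
  rewrite unmarked_beforeS /upd /= t9 (U.2 5 isT) (U1.2 5 isT) sm //.
  rewrite (U.1 4 isT) (U1.1 4 isT) s4.
  case Em: (mk m) => /=; rewrite /upd /=.
    rewrite addn0; split=> // j; rewrite ltnS leq_eqVlt => /orP[/eqP->|lj]; last exact: tv.
    by rewrite Em.
  rewrite (U.1 5 isT) (U1.1 5 isT) s5 t3 ?t9; split=> // j.
  rewrite (U.1 6 isT) (U1.1 6 isT) s6 (U.2 1 isT) (U1.2 1 isT) sv //.
  rewrite ltnS leq_eqVlt => /orP[/eqP->|lj mj]; first by rewrite eqxx.
  by rewrite ltn_eqF ?unmarked_before_lt // tv.
- lia.
Qed.

Lemma copy_spec p s : reg s 5 = 1 -> reg s 6 = p ->
  wp copy_prog s (4 * p + 2) (fun s' =>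
    forall q, arr s' 17 q = if q < p then arr s 1 q else arr s 17 q).
Proof.
move=> s5 s6.
apply: (@wp_for p 2 (fun m s' =>
    forall q, arr s' 17 q = if q < m then arr s 1 q else arr s 17 q)) => //; last by lia.
move=> m t lt U r8 Im; apply: wp_ev => //= q.
rewrite /upd /= r8 (U.2 1 isT) Im ltnS.
by case: (ltngtP q m) => // ->.
Qed.

Lemma shift_word_spec n s (mk y u : nat -> bool) :
  0 < n -> reg s 0 = n -> reg s 4 = 0 -> reg s 5 = 1 ->
  (forall j, j < n -> arr s 5 j = mk j :> nat) ->
  (forall j, j < n -> arr s 0 j = y j :> nat) ->
  (forall j, j < n -> ~~ mk j -> arr s 2 (unmarked_before mk j) = u j :> nat) ->
  (forall j, j < n -> mk j -> u j = false) ->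
  (forall j, arr s 6 j = 0) ->
  wp shift_word_prog s (20 * n) (fun s' =>
    (forall j, j < n -> arr s' 6 j = u j :> nat) /\
    forall j, arr s' 16 j = if j < n then y j (+) u j : nat else arr s 16 j).
Proof.
move=> n0 s0 s4 s5 sm sy su um s6.
apply: (@wp_seq 1 (19 * n) (fun s' => reg s' 18 = 0)) => [||]; [exact: wp_ev | | lia].
move=> s1 U1 r18.
apply: (@wp_for n 12 (fun t s' => [/\ reg s' 18 = unmarked_before mk t,
    (forall j, j < t -> arr s' 6 j = u j :> nat),
    (forall j, t <= j -> arr s' 6 j = 0) &
    forall j, arr s' 16 j = if j < t then y j (+) u j : nat else arr s 16 j])) => //.
- by rewrite (U1.1 5 isT).
- by rewrite (U1.1 0 isT).
- by split=> // j; rewrite ?(U1.2 6 isT) ?(U1.2 16 isT) /=.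
- move=> m t lt U t9 [t18 t6 t6' t16]; apply: wp_ev => //=.
  rewrite unmarked_beforeS /upd /= t9 (U.2 5 isT) (U1.2 5 isT) sm //.
  rewrite (U.1 4 isT) (U1.1 4 isT) s4 (U.2 0 isT) (U1.2 0 isT) sy //.
  case Em: (mk m); rewrite /= /upd /=.
    rewrite t9 addn0; split=> // j.
    + rewrite ltnS leq_eqVlt => /orP[/eqP->|lj]; last exact: t6.
      by rewrite t6' // um.
    + by move=> lj; apply: t6'; apply: ltnW.
    + rewrite t16 ltnS; case: (ltngtP j m) => // ->.
      by rewrite um // addbF.
  rewrite t18 (U.2 2 isT) (U1.2 2 isT) su ?Em // ?t9 ?(U.1 4 isT) ?(U1.1 4 isT) ?s4.
  case Eu: (u m); rewrite /= /upd /= ?t9 (U.1 5 isT) (U1.1 5 isT) s5; split=> // j.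
  + by rewrite ltnS leq_eqVlt; case: (j =P m) => [->|_ /t6 //]; rewrite Eu.
  + by move=> lj; rewrite gtn_eqF // t6' // ltnW.
  + rewrite t16 ltnS; case: (ltngtP j m) => // ->.
    by rewrite Eu; case: (y m).
  + by rewrite ltnS leq_eqVlt; case: (j =P m) => [->|_ /t6 //]; rewrite Eu.
  + by move=> lj; rewrite gtn_eqF // t6' // ltnW.
  + rewrite t16 ltnS; case: (ltngtP j m) => // ->.
    by rewrite Eu addbF.
- by move=> s' U r9 [].
- lia.
Qed.

(** Bits are tested for being nonzero, because the decoder may write any positive number for a 1. *)
Lemma hash_spec a n s m off (w : nat -> bool) :
  0 < n -> 0 < m -> reg s 0 = n -> reg s 4 = 0 -> reg s 5 = 1 -> reg s 20 = m ->
  reg s 22 = off ->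
  (forall j, j < n -> (arr s a (off + j) != 0) = w j) ->
  wp (hash_prog a) s (15 * n) (fun s' => reg s' 21 = binval w n %% m).
Proof.
move=> n0 m0 s0 s4 s5 s20 s22 sw.
apply: (@wp_seq 1 (14 * n) (fun s' => reg s' 21 = 0)) => [||]; [exact: wp_ev | | lia].
move=> s1 U1 r21.
apply: (@wp_for n 9 (fun t s' => reg s' 21 = binval w t %% m)) => //; last by lia.
- by rewrite (U1.1 5 isT).
- by rewrite (U1.1 0 isT).
- by rewrite /= mod0n.
- move=> q t lt U t9 Iq; apply: wp_ev => //=.
  rewrite modn_double_add // -sw //.
  have Ea : arr t a = arr s a by rewrite (U.2 a) // (U1.2 a).
  rewrite /upd /= t9 (U.1 4 isT) (U1.1 4 isT) s4 (U.1 22 isT) (U1.1 22 isT) s22 Ea Iq.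
  rewrite -lt0n addnn; case: (ltnP 0 (arr s a _)) => _; rewrite /= /upd /= ?(U.1 5 isT)
    ?(U1.1 5 isT) ?s5 ?(U.1 20 isT) ?(U1.1 20 isT) ?s20 ?addn0.
    by case: ltnP.
  by case: ltnP.
Qed.

Lemma sum_spec n k s (x v : nat -> bool) :
  reg s 0 = n -> reg s 4 = 0 -> reg s 5 = 1 -> reg s 6 = k * n ->
  (forall j, j < n -> arr s 0 j = x j :> nat) ->
  (forall j, j < n -> arr s 1 (k * n + j) = v j :> nat) ->
  wp sum_prog s (9 * n + 2) (fun s' =>
    forall j, j < n -> arr s' 6 j = x j (+) v j :> nat).
Proof.
move=> s0 s4 s5 s6 sx sv.
apply: (@wp_for n 7 (fun t s' => forall j, j < t -> arr s' 6 j = x j (+) v j :> nat)) => //;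
  last by lia.
move=> m t lt U t9 Im; apply: wp_ev => //= j lj.
rewrite /upd /= t9 (U.1 6 isT) s6 (U.1 4 isT) s4 (U.2 0 isT) (U.2 1 isT) sx // sv //.
move: lj; case Ev: (v m); rewrite /= /upd /= ?t9 ?(U.1 5 isT) ?s5 ltnS leq_eqVlt;
  case: (j =P m) => [-> _|_ /Im //]; rewrite Ev ?addbF //.
by case: (x m).
Qed.

Lemma output_spec n s off (w u : nat -> bool) :
  reg s 0 = n -> reg s 4 = 0 -> reg s 5 = 1 -> reg s 22 = off ->
  (forall j, j < n -> (arr s 19 (off + j) != 0) = w j) ->
  (forall j, j < n -> arr s 6 j = u j :> nat) ->
  wp output_prog s (9 * n + 2) (fun s' =>
    forall j, j < n -> arr s' 3 j = w j (+) u j :> nat).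
Proof.
move=> s0 s4 s5 s22 sw su.
apply: (@wp_for n 7 (fun t s' => forall j, j < t -> arr s' 3 j = w j (+) u j :> nat)) => //;
  last by lia.
move=> m t lt U t9 Im; apply: wp_ev => //= j lj.
rewrite /upd /= t9 (U.1 22 isT) s22 (U.1 4 isT) s4 (U.2 19 isT) (U.2 6 isT) su //.
have := sw m lt; rewrite -lt0n; move: lj.
case: (ltnP 0 (arr s 19 _)) => _; rewrite /= /upd /= ?t9 ?(U.1 5 isT) ?s5 ltnS leq_eqVlt;
  case: (j =P m) => [-> _ <-|_ /Im //] //.
by case: (u m).
Qed.

Lemma width_spec e n s : 0 < n -> reg s 0 = n -> reg s 5 = 1 ->
  wp (width_prog e) s ((3 * e + 12) * n) (fun s' =>
    reg s' 30 = up_log 2 n.+1 * e /\ reg s' 31 = 2 ^ (up_log 2 n.+1 * e)).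
Proof.
move=> n0 s0 s5; set N := up_log 2 n.+1.
have leN : N <= n by apply: up_log_min => //; apply: ltn_expl.
apply: (@wp_seq 1 ((3 * e + 12) * n - 1) (fun s' => reg s' 30 = 0)) => [||];
  [exact: wp_ev | |nia].
move=> s1 U1 r30.
apply: (@wp_seq 1 ((3 * e + 12) * n - 2) (fun s' => reg s' 33 = e)) => [||];
  [exact: wp_ev | |nia].
move=> s2 U2 r33.
apply: (@wp_seq 1 ((3 * e + 12) * n - 3) (fun s' => reg s' 32 = 1)) => [||];
  [exact: wp_ev | |nia].
move=> s3 U3 r32.
apply: (@wp_seq 1 ((3 * e + 12) * n - 4) (fun s' => reg s' 34 = n.+1)) => [||];
  [| |nia].
  apply: wp_ev => //=; rewrite /upd /= (U3.1 0 isT) (U2.1 0 isT) (U1.1 0 isT) s0.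
  by rewrite (U3.1 5 isT) (U2.1 5 isT) (U1.1 5 isT) s5 addn1.
move=> s4 U4 r34.
apply: (@wp_seq (3 * n + 1) (3 * e * n + 4) (fun s' => reg s' 30 = N * e)) => [||];
  [| |nia].
  apply: (@wp_while N 2 (fun m s => reg s 32 = 2 ^ m /\ reg s 30 = m * e)).
  - by rewrite (U4.1 32 isT) r32 (U4.1 30 isT) (U3.1 30 isT) (U2.1 30 isT) r30.
  - move=> m t lt U [t32 t30]; split.
      rewrite t32 (U.1 34 isT) r34 ltnNge; apply/negP => le.
      by move: lt; rewrite ltnNge => /negP; apply; apply: up_log_min.
    apply: wp_ev => //=; rewrite /upd /= t32 t30 (U.1 33 isT) (U4.1 33 isT) (U3.1 33 isT) r33.
    by rewrite addnn -mul2n -expnS mulSn addnC.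
  - move=> t U [t32 t30]; split=> //.
    by rewrite t32 (U.1 34 isT) r34; apply: up_logP.
  - lia.
move=> s5' U5 t30.
apply: (@wp_seq 1 (3 * e * n + 3) (fun s' => reg s' 31 = 1)) => [||]; [exact: wp_ev | |nia].
move=> s6 U6 r31.
have r6 : reg s6 30 = N * e by rewrite (U6.1 30 isT).
apply: (@wp_for (N * e) 1 (fun m s => reg s 31 = 2 ^ m)) => //.
- by rewrite (U6.1 5 isT) (U5.1 5 isT) (U4.1 5 isT) (U3.1 5 isT) (U2.1 5 isT) (U1.1 5 isT).
- move=> m t lt U t9 Im; apply: wp_ev => //=; rewrite /upd /= Im.
  by rewrite addnn -mul2n -expnS.
- by move=> t U t9 It; rewrite (U.1 30 isT).
- nia.
Qed.

Lemma encode_spec B v s : v < 2 ^ B -> reg s 4 = 0 -> reg s 5 = 1 ->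
  reg s 30 = B -> reg s 31 = 2 ^ B -> reg s 35 = v ->
  wp encode_prog s (8 * B + 3) (fun s' => reg s' 3 = B /\
    binval (fun j => arr s' 3 j != 0) B = v).
Proof.
move=> lv s4 s5 s30 s31 s35.
apply: (@wp_seq (8 * B + 2) 1 (fun s' =>
    binval (fun j => arr s' 3 j != 0) B = v)) => [||]; last by lia.
  (* Long division of [v * 2 ^ m] by [2 ^ B]: the bits written so far form the quotient and register
     35 is the remainder. At [m = B] the quotient is [v]. *)
  apply: (@wp_for B 6 (fun m s => reg s 35 < 2 ^ B /\
    binval (fun j => arr s 3 j != 0) m * 2 ^ B + reg s 35 = v * 2 ^ m)) => //.
  - by rewrite /= /upd /= s35 mul0n muln1.
  - move=> m t lt U t9 [l35 Im].
    apply: wp_ev => //=; rewrite /upd /= t9 (U.1 31 isT) s31.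
    have E (f g : nat -> nat) : (forall j, j < m -> f j = g j) ->
        binval (fun j => f j != 0) m = binval (fun j => g j != 0) m.
      by move=> h; apply: eq_binval => j lj; rewrite h.
    case: (ltnP (reg t 35 + reg t 35) (2 ^ B)) => h; rewrite /= /upd /= ?t9 eqxx ?(U.1 4 isT) ?(U.1 5 isT) ?s4 ?s5 /=.
      rewrite (E _ (arr t 3)) => [|j lj]; last by rewrite ltn_eqF.
      by split=> //; rewrite addn0 expnS; nia.
    rewrite (E _ (arr t 3)) => [|j lj]; last by rewrite ltn_eqF.
    rewrite ?(U.1 31 isT) ?s31; split; first by lia.
    by rewrite expnS; nia.
  - move=> t U t9 [l35 It]; set b := binval _ B in It *.
    by move: It (expn_gt0 2 B) l35 => /=; nia.
  - by lia.
move=> s' U h; apply: wp_ev => //=; split; last by [].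
by rewrite /upd /= (U.1 30 isT).
Qed.

Lemma decode_spec B s (b : nat -> bool) : reg s 5 = 1 -> reg s 2 = B ->
  (forall j, j < B -> arr s 2 j = b j :> nat) ->
  wp decode_prog s (5 * B + 3) (fun s' => reg s' 36 = binval b B).
Proof.
move=> s5 s2 sb.
apply: (@wp_seq 1 (5 * B + 2) (fun s' => reg s' 36 = 0)) => [||]; [exact: wp_ev | |lia].
move=> s1 U1 r36.
apply: (@wp_for B 3 (fun m s => reg s 36 = binval b m)) => //; last by lia.
- by rewrite (U1.1 5 isT).
- by rewrite (U1.1 2 isT).
- move=> m t lt U t9 Im; apply: wp_ev => //=; rewrite /upd /= t9 Im addnn.
  by rewrite (U.2 2 isT) (U1.2 2 isT) sb.
Qed.

End Programs.

                          

(** * A small modulus separating a list of integers *)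

Section Modulus.
Local Open Scope nat_scope.

Definition separates (a : nat -> nat) (l m : nat) : bool :=
  uniq (mkseq (fun i => a i %% m) l).

                                                      
                                                                              
(** The numbers [N.+1 * 'C(N, k)] are the denominators of the Leibniz harmonic triangle, in which
    the entry [(N+1, k+1)] is the entry [(N, k)] minus the entry [(N+1, k)]. Multiplied by [D], the
    right-hand side is a difference of integers by induction. *)
Lemma dvdn_leibniz M D : (forall m, 0 < m <= M -> m %| D) ->
  forall k N, k <= N < M -> N.+1 * 'C(N, k) %| D.
Proof.
move=> dvd; elim=> [|k IH] N /andP[kN NM]; first by rewrite bin0 muln1 dvd.
case: N kN NM => // N kN NM.
have /dvdnP[q1 E1] : N.+1 * 'C(N, k) %| D by apply: IH; lia.
have /dvdnP[q2 E2] : N.+2 * 'C(N.+1, k) %| D by apply: IH; lia.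
have B1 : N.+1 * 'C(N, k) = k.+1 * 'C(N.+1, k.+1) by rewrite -mul_bin_diag.
have B2 : k.+1 * 'C(N.+1, k.+1) = (N.+1 - k) * 'C(N.+1, k) by rewrite mul_bin_left.
set X := 'C(N.+1, k.+1) in B1 B2 *; set Y := 'C(N.+1, k) in B2 E2.
have E : q1 * (N.+2 * X) = D + q2 * (N.+2 * X).
  apply/eqP; rewrite -(eqn_pmul2l (ltn0Sn k)); apply/eqP.
  have -> : k.+1 * (q1 * (N.+2 * X)) = N.+2 * D by rewrite E1 B1; nia.
  rewrite mulnDr.
  have -> : k.+1 * (q2 * (N.+2 * X)) = (N.+1 - k) * D.
    have -> : k.+1 * (q2 * (N.+2 * X)) = q2 * N.+2 * (k.+1 * X) by nia.
    by rewrite B2 E2; nia.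
  by rewrite -mulnDl; congr (_ * _); lia.
have : N.+2 * X %| D + q2 * (N.+2 * X) by rewrite -E dvdn_mull.
by rewrite dvdn_addl // dvdn_mull.
Qed.

(** Each [M.+1 * 'C(M, k)] divides [D] and so is at most [D]; summing over the [M.+1] values of [k]
    gives [M.+1 * 2 ^ M <= M.+1 * D]. *)
Lemma expn_le_common_multiple M D : 0 < D ->
  (forall m, 0 < m <= M.+1 -> m %| D) -> 2 ^ M <= D.
Proof.
move=> D0 dvd; rewrite -(leq_pmul2l (ltn0Sn M)) -[2]/(1 + 1) expnDn.
under eq_bigr => i _ do rewrite !exp1n !muln1.
rewrite big_distrr /=; apply: leq_trans (_ : \sum_(i < M.+1) D <= _).
  apply: leq_sum => i _; apply: dvdn_leq => //.
  by apply: dvdn_leibniz dvd _ _ _; rewrite -ltnS ltn_ord ltnSn.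
by rewrite sum_nat_const card_ord.
Qed.

Lemma exists_separating n l (a : nat -> nat) :
  (forall i, i < l -> a i < 2 ^ n) ->
  (forall i j, i < l -> j < l -> a i = a j -> i = j) ->
  exists2 m, 0 < m <= n * l ^ 2 + 2 & separates a l m.
Proof.
move=> la inj.
have [/existsP[m /andP[m0 sep]]|none] :=
  boolP [exists m : 'I_((n * l ^ 2 + 2).+1), (0 < m) && separates a l m].
  by exists (val m) => //; rewrite m0 -ltnS ltn_ord.
(* The absolute difference, as a sum of two truncated subtractions, with value 1 in the equal case
   so that the product [D] stays positive. *)
pose dist i j := (if a i == a j then 1 else (a i - a j) + (a j - a i)).
pose D := \prod_(i < l) \prod_(j < l) dist i j.
have dist0 i j : 0 < dist i j by rewrite /dist; case: eqP => // ?; lia.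
have D0 : 0 < D by apply: prodn_gt0 => i; apply: prodn_gt0 => j; apply: dist0.
have leD : D <= 2 ^ (n * l ^ 2).
  have -> : 2 ^ (n * l ^ 2) = \prod_(i < l) \prod_(j < l) 2 ^ n.
    rewrite big_const_ord iter_muln_1 big_const_ord iter_muln_1 -!expnM.
    by rewrite -mulnn mulnA.
  apply: leq_prod => i _; apply: leq_prod => j _; rewrite /dist.
  have := la i (ltn_ord i); have := la j (ltn_ord j).
  by case: eqP => _; lia.
have dvdD m : 0 < m <= n * l ^ 2 + 2 -> m %| D.
  move=> /andP[m0 lm]; move/existsPn: none => /(_ (Ordinal (lm : m < _.+1))) /=.
  rewrite m0 /= => /(uniqPn 0)[i [j [lij]]]; rewrite size_mkseq => lj.
  have li : i < l by apply: ltn_trans lj.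
  rewrite !nth_mkseq // => E.
  rewrite /D (bigD1 (Ordinal li)) //= (bigD1 (Ordinal lj)) //= -mulnA dvdn_mulr //.
  rewrite /dist; case: eqP => [/(inj _ _ li lj) Eij|_].
    by rewrite Eij ltnn in lij.
  have [h|h] := leqP (a i) (a j).
    by rewrite (eqP (h : a i - a j == 0)) add0n -eqn_mod_dvd // eq_sym E.
  by rewrite (eqP (ltnW h : a j - a i == 0)) addn0 -eqn_mod_dvd ?E // ltnW.
(* All [m] up to [n * l ^ 2 + 2] divide [D], so [2 ^ (n * l ^ 2 + 1) <= D <= 2 ^ (n * l ^ 2)], a
   contradiction. *)
have := @expn_le_common_multiple (n * l ^ 2).+1 D D0.
rewrite -addn2 => /(_ dvdD) h.
have := leq_trans h leD; rewrite leq_exp2l // ltnn; by [].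
Qed.

End Modulus.

(** * Searching for the least separating modulus *)

Section Search.
Local Open Scope nat_scope.

                                                                               
                                                  
(** Array 7 is a table indexed by residues and stamped with the current modulus: a stamp below it is
    a leftover from an earlier modulus, so the table is never cleared. A current stamp signals a
    collision and resets register 23. Array 8 records the offset of the word having a given
    residue. *)
Definition candidate_prog : cmd :=
  Seq (hash_prog 19) (Seq (Read 24 7 21) (Seq (IfLt 24 20 Skip (Const 23 0))
    (Seq (Write 7 21 20) (Seq (Write 8 21 22) (Add 22 22 0))))).

Definition search_prog : cmd :=
  Seq (Const 20 0) (Seq (Const 23 0) (WhileLt 23 5
    (Seq (Add 20 20 5) (Seq (Const 23 1) (Seq (Const 22 0) (For 8 67 candidate_prog)))))).

Definition candidates_done n (a : nat -> nat) m i (s : store) : Prop :=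
  [/\ reg s 22 = i * n, reg s 23 = separates a i m :> nat,
      forall v, (arr s 7 v == m) = (v \in mkseq (fun i => a i %% m) i),
      forall v, arr s 7 v <= m
    & separates a i m -> forall i', i' < i -> arr s 8 (a i' %% m) = i' * n].

Lemma candidate_spec n l (w : nat -> nat -> bool) m i s :
  0 < n -> 0 < m -> reg s 0 = n -> reg s 4 = 0 -> reg s 5 = 1 -> reg s 20 = m ->
  i < l ->
  (forall i j, i < l -> j < n -> (arr s 19 (i * n + j) != 0) = w i j) ->
  candidates_done n (fun i => binval (w i) n) m i s ->
  wp candidate_prog s (15 * n + 7) (candidates_done n (fun i => binval (w i) n) m i.+1).
Proof.
move=> n0 m0 s0 s4 s5 s20 li sw [s22 s23 s7 s7m s8].
apply: (@wp_seq (15 * n) 7 (fun s' => reg s' 21 = binval (w i) n %% m)) => //.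
  by apply: (hash_spec _ _ _ _ _ _ n0 m0 s0 s4 s5 s20 s22) => // j lj; apply: sw.
move=> t U r21; apply: wp_ev => //.
rewrite /candidates_done /separates mkseqS rcons_uniq -s7; set h := _ %% m in r21 *.
rewrite /= /upd /= r21 (U.1 20 isT) s20 (U.2 7 isT).
have -> : (arr s 7 h < m) = (arr s 7 h != m) by rewrite ltn_neqAle s7m andbT.
have E0 : i * n + n = i.+1 * n by rewrite mulSn addnC.
have E7 v : ((if v == h then m else arr s 7 v) == m) =
    (v \in rcons (mkseq (fun i => binval (w i) n %% m) i) h).
  by rewrite mem_rcons inE -s7; case: (v =P h) => //= _; rewrite eqxx.
have E7m v : (if v == h then m else arr s 7 v) <= m by case: ifP.
case Eh: (arr s 7 h == m); rewrite /= /upd /= ?r21 ?(U.1 20 isT) ?s20 ?(U.2 7 isT)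
  ?(U.1 0 isT) ?(U.1 22 isT) ?s0 ?s22; split; rewrite ?E0 //.
  by rewrite (U.1 23 isT) s23.
move=> sep i'; rewrite ltnS leq_eqVlt => /orP[/eqP->|li']; first by rewrite eqxx.
case: eqP => [E|_]; last by rewrite (U.2 8 isT) s8.
move: Eh; rewrite s7 -E => /negP[]; apply/mapP; exists i' => //.
by rewrite mem_iota.
Qed.

Lemma search_spec n l (w : nat -> nat -> bool) M s :
  0 < n -> 0 < l -> 0 < M -> reg s 0 = n -> reg s 4 = 0 -> reg s 5 = 1 -> reg s 67 = l ->
  (forall i j, i < l -> j < n -> (arr s 19 (i * n + j) != 0) = w i j) ->
  (forall v, arr s 7 v = 0) ->
  separates (fun i => binval (w i) n) l M ->
  (forall m, 0 < m < M -> ~~ separates (fun i => binval (w i) n) l m) ->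
  wp search_prog s (40 * (M * (l * n))) (fun s' => reg s' 20 = M /\
     forall i, i < l -> arr s' 8 (binval (w i) n %% M) = i * n).
Proof.
move=> n0 l0 M0 s0 s4 s5 s67 sw s7 sepM minM.
have Mln : M <= M * (l * n) by rewrite leq_pmulr // muln_gt0 l0.
set a := (fun i => binval (w i) n) in sepM minM *.
apply: (@wp_seq 1 (39 * (M * (l * n))) (fun s' => reg s' 20 = 0)) => [||];
  [exact: wp_ev | |lia].
move=> s1 U1 r20.
apply: (@wp_seq 1 (38 * (M * (l * n))) (fun s' => reg s' 23 = 0)) => [||];
  [exact: wp_ev | |lia].
move=> s2 U2 r23.
(* The guard [0 < m] matches the flag being cleared before the first modulus is tried. Minimality of
   [M] keeps the loop running until [M] is reached. *)
apply: (@wp_while M (l * (15 * n + 9) + 5) (fun m s => [/\ reg s 20 = m,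
  reg s 23 = (0 < m) && separates a l m :> nat, forall v, arr s 7 v <= m &
  (0 < m) && separates a l m -> forall i, i < l -> arr s 8 (a i %% m) = i * n])).
- split=> //; first by rewrite (U2.1 20 isT).
  by move=> v; rewrite (U2.2 7 isT) (U1.2 7 isT) s7.
- move=> m t lt U [t20 t23 t7 t8].
  have t5 : reg t 5 = 1 by rewrite (U.1 5 isT) (U2.1 5 isT) (U1.1 5 isT).
  split.
    by rewrite t5 t23; case: m lt {t20 t23 t7 t8} => //= m lt; rewrite (negPf (minM _ _)).
  apply: (@wp_seq 1 (l * (15 * n + 9) + 4) (fun s' => reg s' 20 = m.+1)) => [||];
    [|  | lia].
    by apply: wp_ev => //=; rewrite /upd /= t20 t5 addn1.
  move=> t1 V1 v20.
  apply: (@wp_seq 1 (l * (15 * n + 9) + 3) (fun s' => reg s' 23 = 1)) => [||];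
    [exact: wp_ev |  | lia].
  move=> t2 V2 v23.
  apply: (@wp_seq 1 (l * (15 * n + 9) + 2) (fun s' => reg s' 22 = 0)) => [||];
    [exact: wp_ev |  | lia].
  move=> t3 V3 v22.
  apply: (@wp_for l (15 * n + 7) (candidates_done n a m.+1)) => //.
  + by rewrite (V3.1 5 isT) (V2.1 5 isT) (V1.1 5 isT).
  + by rewrite (V3.1 67 isT) (V2.1 67 isT) (V1.1 67 isT) (U.1 67 isT) (U2.1 67 isT) (U1.1 67 isT).
  + split=> //=; rewrite /upd /=; first by rewrite (V3.1 23 isT) v23.
      by move=> v; rewrite (V3.2 7 isT) (V2.2 7 isT) (V1.2 7 isT) ltn_eqF // ltnS t7.
    by move=> v; rewrite (V3.2 7 isT) (V2.2 7 isT) (V1.2 7 isT) leqW.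
  + move=> i u li V u8 Ii.
    apply: wp_conseq.
    * apply: (@candidate_spec n l w m.+1 i u) => //.
      - by rewrite (V.1 0 isT) (V3.1 0 isT) (V2.1 0 isT) (V1.1 0 isT) (U.1 0 isT) (U2.1 0 isT) (U1.1 0 isT).
      - by rewrite (V.1 4 isT) (V3.1 4 isT) (V2.1 4 isT) (V1.1 4 isT) (U.1 4 isT) (U2.1 4 isT) (U1.1 4 isT).
      - by rewrite (V.1 5 isT) (V3.1 5 isT) (V2.1 5 isT) (V1.1 5 isT).
      - by rewrite (V.1 20 isT) (V3.1 20 isT) (V2.1 20 isT).
      - move=> i' j li' lj.
        by rewrite (V.2 19 isT) (V3.2 19 isT) (V2.2 19 isT) (V1.2 19 isT) (U.2 19 isT)
          (U2.2 19 isT) (U1.2 19 isT) sw.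
    * by [].
    * by [].
  + move=> u V u8 [u22 u23 u7 u7m u8']; split=> //.
    by rewrite (V.1 20 isT) (V3.1 20 isT) (V2.1 20 isT).
  + by lia.
- move=> t U [t20 t23 t7 t8]; move: t23 t8; rewrite M0 sepM /= => t23 t8.
  by split; [rewrite t23 (U.1 5 isT) (U2.1 5 isT) (U1.1 5 isT) s5 | split=> //; apply: t8].
- nia.
Qed.

End Search.

(** * Running the decoder in a disjoint part of memory *)

Section Shift.
Local Open Scope nat_scope.

                                                                              
                                                                                 
(** The decoder is arbitrary and may write anywhere. Moved to registers from 64 and arrays from 16
    on, it takes the same number of steps and leaves the memory of the protocol intact. *)
Fixpoint relocate (c : cmd) : cmd :=
  match c with
  | Skip => Skip
  | Const i v => Const (64 + i) v
  | Move i j => Move (64 + i) (64 + j)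
  | Add i j l => Add (64 + i) (64 + j) (64 + l)
  | Defs.Sub i j l => Defs.Sub (64 + i) (64 + j) (64 + l)
  | Read i a j => Read (64 + i) (16 + a) (64 + j)
  | Write a j i => Write (16 + a) (64 + j) (64 + i)
  | Seq c1 c2 => Seq (relocate c1) (relocate c2)
  | IfLt i j c1 c2 => IfLt (64 + i) (64 + j) (relocate c1) (relocate c2)
  | WhileLt i j c => WhileLt (64 + i) (64 + j) (relocate c)
  end.

Definition relocated (s S : store) : Prop :=
  (forall i, reg S (64 + i) = reg s i) /\
  (forall a p, arr S (16 + a) p = arr s a p).

Lemma relocated_set_reg s S i v :
  relocated s S -> relocated (set_reg s i v) (set_reg S (64 + i) v).
Proof.
by move=> [hr ha]; split=> // j; rewrite /= /upd eqn_add2l hr.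
Qed.

Lemma exec_relocate c s s' t : exec c s s' t ->
  forall S, relocated s S -> exists S', exec (relocate c) S S' t /\ relocated s' S'.
Proof.
elim=> {c s s' t}.
- by move=> s S h; exists S; split=> //; apply: ExecSkip.
- by move=> s i v S h; eexists; split; [apply: ExecConst | apply: relocated_set_reg].
- move=> s i j S h; eexists; split; first exact: ExecMove.
  by rewrite h.1; apply: relocated_set_reg.
- move=> s i j l S h; eexists; split; first exact: ExecAdd.
  by rewrite !h.1; apply: relocated_set_reg.
- move=> s i j l S h; eexists; split; first exact: ExecSub.
  by rewrite !h.1; apply: relocated_set_reg.
- move=> s i a j S h; eexists; split; first exact: ExecRead.
  by rewrite !h.1 h.2; apply: relocated_set_reg.
- move=> s a j i S h; eexists; split; first exact: ExecWrite.
  rewrite !h.1; split=> [r|b p]; first exact: h.1.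
  rewrite /= /upd eqn_add2l; case: (b =P a) => [_|_]; last exact: h.2.
  by case: (p == _) => //; apply: h.2.
- move=> c1 c2 s s1 s2 t1 t2 _ IH1 _ IH2 S /IH1[S1 [e1 /IH2[S2 [e2 h2]]]].
  by exists S2; split=> //; apply: ExecSeq e1 e2.
- move=> i j c1 c2 s s' t lt _ IH S h; have [S' [e h']] := IH S h.
  by exists S'; split=> //; apply: ExecIfTrue => //; rewrite !h.1.
- move=> i j c1 c2 s s' t lt _ IH S h; have [S' [e h']] := IH S h.
  by exists S'; split=> //; apply: ExecIfFalse => //; rewrite !h.1.
- move=> i j c s s1 s2 t1 t2 lt _ IH1 _ IH2 S h.
  have [S1 [e1 h1]] := IH1 S h; have [S2 [e2 h2]] := IH2 S1 h1.
  by exists S2; split=> //; apply: ExecWhileTrue e1 e2; rewrite !h.1.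
- move=> i j c s le S h; exists S; split=> //.
  by apply: ExecWhileFalse; rewrite !h.1.
Qed.

Lemma modr_relocate c r : r < 64 -> modr (relocate c) r = false.
Proof.
move=> lr; have ne i : (r == 64 + i) = false.
  by apply/negbTE; rewrite neq_ltn (leq_trans lr) // leq_addr.
by elim: c => [|i v|i j|i j l|i j l|i b j|b j i|c1 IH1 c2 IH2|i j c1 IH1 c2 IH2|i j c IH];
  rewrite [LHS]/= ?IH1 ?IH2 //; apply: ne.
Qed.

Lemma moda_relocate c a : a < 16 -> moda (relocate c) a = false.
Proof.
move=> la; have ne i : (a == 16 + i) = false.
  by apply/negbTE; rewrite neq_ltn (leq_trans la) // leq_addr.
by elim: c => [|i v|i j|i j l|i j l|i b j|b j i|c1 IH1 c2 IH2|i j c1 IH1 c2 IH2|i j c IH];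
  rewrite [LHS]/= ?IH1 ?IH2 //; apply: ne.
Qed.

End Shift.

                                      

(** * Words over the two-element field and their bits *)

Section Words.
Local Open Scope ring_scope.

Lemma F2_bit (a : 'F_2) : (a != 0)%:R = a.
Proof. by case: a => [[|[|]]] //= ?; apply/val_inj. Qed.

Lemma F2_xor (b c : bool) : (b (+) c)%:R = b%:R + c%:R :> 'F_2.
Proof. by case: b; case: c; apply/val_inj. Qed.

Lemma F2_bit_neq0 (b : bool) : ((b%:R : 'F_2) != 0) = b.
Proof. by case: b. Qed.

Lemma word_addxx m n (M : 'M['F_2]_(m, n)) : M + M = 0.
Proof.
apply/matrixP => i j; rewrite !mxE -(F2_bit (M i j)) -F2_xor addbb; by [].
Qed.

Definition of_bits n (v : nat -> bool) : word n := \row_(j < n) (v j)%:R.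

Lemma matrix_arrayE m n (M : 'M['F_2]_(m, n)) (i : 'I_m) (j : 'I_n) :
  matrix_array M (i * n + j)%N = (M i j != 0).
Proof.
rewrite /matrix_array; congr (nat_of_bool _); apply/existsP/idP.
  move=> [i' /existsP[j' /andP[]]]; rewrite offset_inj // => /andP[/eqP Ei /eqP Ej].
  by rewrite (ord_inj Ei) (ord_inj Ej).
by move=> h; exists i; apply/existsP; exists j; rewrite eqxx.
Qed.

Lemma matrix_array_out m n (M : 'M['F_2]_(m, n)) p :
  (m * n <= p)%N -> matrix_array M p = 0%N.
Proof.
move=> le; rewrite /matrix_array; case: existsP => // -[i /existsP[j /andP[/eqP E _]]].
have := ltn_ord i; have := ltn_ord j; move: le; rewrite E; nia.
Qed.

Lemma matrix_array_bit m n (M : 'M['F_2]_(m, n)) p :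
  matrix_array M p = (matrix_array M p != 0%N).
Proof. by rewrite /matrix_array; case: [exists _, _]. Qed.

Definition bits n (w : word n) (j : nat) : bool := matrix_array w j != 0%N.

Lemma bitsE n (w : word n) (j : 'I_n) : bits n w j = (w 0 j != 0).
Proof.
by rewrite /bits (_ : j = (ord0 : 'I_1) * n + j :> nat)%N // matrix_arrayE eqb0 negbK.
Qed.

Lemma bitsK n (w : word n) : of_bits n (bits n w) = w.
Proof. by apply/rowP => j; rewrite mxE bitsE F2_bit. Qed.

Lemma of_bitsE n (v : nat -> bool) j : (j < n)%N -> bits n (of_bits n v) j = v j.
Proof. by move=> lj; rewrite (bitsE _ _ (Ordinal lj)) mxE F2_bit_neq0. Qed.

Lemma of_bits_xor n (v v' : nat -> bool) :
  of_bits n (fun j => v j (+) v' j) = of_bits n v + of_bits n v'.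
Proof. by apply/rowP => j; rewrite !mxE F2_xor. Qed.

Lemma eq_of_bits n (v v' : nat -> bool) :
  (forall j, (j < n)%N -> v j = v' j) -> of_bits n v = of_bits n v'.
Proof. by move=> h; apply/rowP => j; rewrite !mxE h. Qed.

Lemma bitsD n (v w : word n) j : (j < n)%N -> bits n (v + w) j = bits n v j (+) bits n w j.
Proof. by move=> lj; rewrite -{1}(bitsK n v) -{1}(bitsK n w) -of_bits_xor of_bitsE. Qed.

Definition augmented k n (G : 'M['F_2]_(k, n)) (x : word n) (r j : nat) : bool :=
  if (r < k)%N then matrix_array G (r * n + j)%N != 0%N else bits n x j.

End Words.

(** * Correctness of the elimination *)

Section EliminationTheory.
Local Open Scope ring_scope.
Variables (k n : nat) (G : 'M['F_2]_(k, n)) (x : word n).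
Hypothesis G_free : row_free G.

Local Notation A := (augmented k n G x).
Local Notation rows i := (\matrix_(r < k) of_bits n (elim n A i r)).

(** The linear-algebra form of a step: a multiple of row [i] is added, and the multiple is zero on
    rows up to [i]. *)
Lemma of_bits_elim_step (B : nat -> nat -> bool) i r : exists c : 'F_2,
  of_bits n (elim_step n B i r) = of_bits n (B r) + c *: of_bits n (B i)
  /\ ((r <= i)%N -> c = 0).
Proof.
rewrite /elim_step; case E: ((i < r)%N && _).
  move/andP: E => [lt _].
  by exists 1; rewrite of_bits_xor scale1r leqNgt lt.
by exists 0; rewrite scale0r addr0.
Qed.

Lemma elim_rows i : (i <= k)%N -> (rows i :=: G)%MS.
Proof.
elim: i => [_|i IH lt].
  suff -> : rows 0%N = G by [].
  apply/matrixP => r j; rewrite !mxE /augmented /= ltn_ord matrix_arrayE eqb0 negbK.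
  exact: F2_bit.
apply: eqmx_trans (IH (ltnW lt)); apply/eqmxP/andP; split; apply/row_subP => r;
  have [c [E Ec]] := of_bits_elim_step (elim n A i) i r.
  rewrite rowK [elim _ _ _.+1]/= E addmx_sub ?scalemx_sub //.
    by rewrite -(rowK (fun r => of_bits n (elim n A i r))) row_sub.
  by rewrite -(rowK (fun r : 'I_k => of_bits n (elim n A i r)) (Ordinal lt)) row_sub.
(* For the converse inclusion: step [i] leaves row [i] itself unchanged, so in characteristic 2
   adding the same multiple of it again undoes the step. *)
have [c' [E' /(_ (leqnn i))Ec']] := of_bits_elim_step (elim n A i) i i.
rewrite rowK; have -> : of_bits n (elim n A i r) =
    of_bits n (elim n A i.+1 r) + c *: of_bits n (elim n A i.+1 i).
  rewrite [elim _ _ _.+1]/= E E' Ec' scale0r addr0 -addrA -scalerDl.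
  by rewrite -[c]F2_bit -F2_xor addbb scale0r addr0.
rewrite addmx_sub ?scalemx_sub //.
  by rewrite -(rowK (fun r => of_bits n (elim n A i.+1 r))) row_sub.
by rewrite -(rowK (fun r : 'I_k => of_bits n (elim n A i.+1 r)) (Ordinal lt)) row_sub.
Qed.

(** The appended row starts as [x] and only ever receives rows of the span of [G]. Hence at every
    stage it differs from [x] by a codeword, the sum being the difference in characteristic 2. *)
Lemma elim_last i : (i <= k)%N -> ((x + of_bits n (elim n A i k))%R <= G)%MS.
Proof.
elim: i => [_|i IH lt].
  have -> : of_bits n (elim n A 0 k) = x.
    by rewrite -[RHS]bitsK; apply: eq_of_bits => j _; rewrite /= /augmented ltnn.
  by rewrite word_addxx sub0mx.
have [c [-> _]] := of_bits_elim_step (elim n A i) i k.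
rewrite addrA addmx_sub ?IH ?scalemx_sub //; first exact: ltnW.
rewrite -(elim_rows i (ltnW lt)).
by rewrite -(rowK (fun r : 'I_k => of_bits n (elim n A i r)) (Ordinal lt)) row_sub.
Qed.

(** The row operations keep the first [k] rows independent, so row [i] is nonzero and its [lastnz]
    is a true nonzero entry. *)
Lemma elim_pivot i : (i < k)%N -> elim n A i i (pivot n A i).
Proof.
move=> lt; have [/existsP[j hj]|none] := boolP [exists j : 'I_n, elim n A i i j].
  exact: lastnzP hj.
have free : row_free (rows i).
  by rewrite /row_free (elim_rows i (ltnW lt)).
have : row (Ordinal lt) (rows i) = 0.
  rewrite rowK; apply/rowP => j; rewrite !mxE.
  by move/existsPn: none => /(_ j) /negPf ->.
rewrite rowE => E; have := row_free_inj free (etrans E (esym (mul0mx _ _))).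
move=> /matrixP/(_ 0 (Ordinal lt)); rewrite !mxE !eqxx; by [].
Qed.

(** Step [i'] clears this column below row [i']; later steps only add rows that already vanish
    there. *)
Lemma elim_pivot_zero i i' r : (i <= k)%N -> (i' < i)%N -> (i' < r)%N ->
  elim n A i r (pivot n A i') = false.
Proof.
elim: i r => // i IH r lt; rewrite ltnS leq_eqVlt => /orP[/eqP->|li'] lr.
  rewrite /= /elim_step -/(pivot n A i) lr /=.
  by case E: (elim n A i r _) => //; rewrite elim_pivot.
by rewrite /= /elim_step !IH ?(ltnW lt) //; case: ifP.
Qed.

(** Row [i] is 1 at its own pivot and 0 at the pivot of every earlier row. *)
Lemma pivot_inj i i' : (i < k)%N -> (i' < k)%N -> pivot n A i = pivot n A i' -> i = i'.
Proof.
wlog lt : i i' / (i' <= i)%N.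
  by move=> W li li' E; have [/W->//|/ltnW/W->] := leqP i' i.
move=> li li' E; case: (ltngtP i' i) lt => // lt _.
by have := elim_pivot i li; rewrite E elim_pivot_zero // ltnW.
Qed.

Lemma marked_last j : marked n A k j -> elim n A k k j = false.
Proof.
by move=> /hasP[i]; rewrite mem_iota => /= li /eqP <-; rewrite elim_pivot_zero.
Qed.

Lemma unmarked_count : (0 < n)%N -> unmarked_before (marked n A k) n = (n - k)%N.
Proof.
move=> n0; rewrite /unmarked_before.
have := count_predC (marked n A k) (iota 0 n); rewrite size_iota.
suff : count (marked n A k) (iota 0 n) = k by move=> -> E; rewrite -[in RHS]E addKn.
rewrite -size_filter -[RHS](size_mkseq (pivot n A) k); apply: perm_size.
apply: uniq_perm; first by rewrite filter_uniq ?iota_uniq.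
  by apply/mkseq_uniqP => i i'; rewrite !inE; apply: pivot_inj.
move=> j; rewrite mem_filter mem_iota /= add0n; apply/andP/mapP.
  by move=> [/hasP[i li /eqP <-] _]; exists i.
move=> [i li ->]; split; first by apply/hasP; exists i.
exact: lastnz_lt.
Qed.

End EliminationTheory.

Section EliminationIndependent.
Local Open Scope nat_scope.

(** Rows are added downwards only, so the appended word never influences the first [k] rows. This is
    why Alice and Bob find the same pivots. *)
Lemma elim_augmented k n (G : 'M['F_2]_(k, n)) x y i r : i <= k -> r < k ->
  elim n (augmented k n G x) i r = elim n (augmented k n G y) i r.
Proof.
elim: i r => [|i IH] r li lr /=; first by rewrite /augmented lr.
by rewrite /elim_step !IH // ltnW.
Qed.

Lemma marked_augmented k n (G : 'M['F_2]_(k, n)) x y j :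
  marked n (augmented k n G x) k j = marked n (augmented k n G y) k j.
Proof.
apply: eq_in_has => i; rewrite mem_iota => /= li.
by rewrite /pivot (elim_augmented k n G x y) // ltnW.
Qed.

End EliminationIndependent.

                                  

(** * The four programs of the protocol *)

Section Turns.
Local Open Scope nat_scope.

Definition alice1_prog : cmd :=
  Seq init_prog (Seq append_prog (Seq elim_prog emit_prog)).

(** The matrix is copied to array 17 first, because elimination overwrites array 1 and the decoder
    must be given the original generator matrix. *)
Definition bob_prog (D : cmd) (e : nat) : cmd :=
  Seq init_prog (Seq copy_prog (Seq append_prog (Seq elim_prog (Seq shift_word_prog
    (Seq (Seq (Move 64 0) (Move 65 1)) (Seq (relocate D) (Seq search_prog
      (Seq (width_prog e) (Seq (Move 35 20) encode_prog))))))))).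

Definition alice2_prog (e : nat) : cmd :=
  Seq decode_prog (Seq (Move 20 36) (Seq sum_prog (Seq (Const 22 0)
    (Seq (hash_prog 6) (Seq (width_prog e) (Seq (Move 35 21) encode_prog)))))).

Definition final_prog : cmd := Seq decode_prog (Seq (Read 22 8 36) output_prog).

Lemma wp_seqB T1 Q1 c1 c2 s T Q :
  wp c1 s T1 Q1 -> (forall s1, unch c1 s s1 -> Q1 s1 -> wp c2 s1 (T - T1) Q) ->
  T1 <= T -> wp (Seq c1 c2) s T Q.
Proof. by move=> h1 h2 le; apply: wp_seq h1 h2 _; rewrite subnKC. Qed.

Definition base n (s : store) : Prop := [/\ reg s 0 = n, reg s 4 = 0 & reg s 5 = 1].

Lemma base_unch {n c s s'} : unch c s s' -> base n s ->
  [&& ~~ modr c 0, ~~ modr c 4 & ~~ modr c 5] -> base n s'.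
Proof. by move=> U [b0 b4 b5] /and3P[m0 m4 m5]; split; rewrite U.1. Qed.

Section Reduced.
Variables (k n : nat) (G : 'M['F_2]_(k, n)) (x : word n).

                                                                       
(** The word [u]: the canonical representative of [x] modulo the code, playing the part of the
    syndrome. *)
Definition residue (j : nat) : bool := elim n (augmented k n G x) k k j.

Definition is_pivot (j : nat) : bool := marked n (augmented k n G x) k j.

End Reduced.

(** Stated with a continuation [c], so that it applies in the middle of the sequences of both Alice
    and Bob. *)
Lemma prepare_spec k n (G : 'M['F_2]_(k, n)) (z : word n) s :
  0 < n -> k <= n -> base n s -> reg s 6 = k * n -> reg s 7 = k.+1 * n ->
  arr s 0 = matrix_array z -> arr s 1 = matrix_array G -> (forall j, arr s 5 j = 0) ->
  forall c T Q,
  (forall s', unch (Seq append_prog elim_prog) s s' ->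
     mat n k s' (elim n (augmented k n G z) k) ->
     (forall j, arr s' 5 j = is_pivot k n G z j :> nat) ->
     wp c s' (T - (5 * n + 2) - 50 * n ^ 3) Q) ->
  (5 * n + 2) + 50 * n ^ 3 <= T ->
  wp (Seq append_prog (Seq elim_prog c)) s T Q.
Proof.
move=> n0 kn [s0 s4 s5] s6 s7 sz sG sp c T Q h leT.
apply: (@wp_seqB (5 * n + 2) (fun s' => mat n k s' (augmented k n G z))) => [||]; last lia.
  apply: (append_spec n k s (fun i j => matrix_array G (i * n + j) != 0) (bits n z)) => //.
    by move=> j _; rewrite sz; apply: matrix_array_bit.
  by move=> i j _ _; rewrite sG; apply: matrix_array_bit.
move=> s1 U1 M1.
have b1 := base_unch U1 (And3 s0 s4 s5 : base n s) isT.
have [t0 t4 t5] := b1.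
apply: (@wp_seqB (50 * n ^ 3) (fun s' => mat n k s' (elim n (augmented k n G z) k) /\
    forall j, arr s' 5 j = is_pivot k n G z j :> nat)) => [||]; last lia.
  apply: elim_spec => //; first by rewrite (U1.1 6 isT).
    by rewrite (U1.1 7 isT).
  by rewrite (U1.2 5 isT).
move=> s2 U2 [M2 m2]; apply: h => //.
apply: (@unch_trans _ _ s1).
  by apply: unch_weaken U1 => r /= ->.
by apply: unch_weaken U2 => r /= ->; rewrite orbT.
Qed.

Lemma alice1_spec k n (G : 'M['F_2]_(k, n)) (x : word n) :
  0 < n -> k <= n -> row_free G ->
  wp alice1_prog (input_store G x) (81 * n ^ 3) (fun s => [/\
    base n s /\ reg s 6 = k * n, reg s 3 = n - k,
    forall j, j < n -> ~~ is_pivot k n G x j ->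
      arr s 3 (unmarked_before (is_pivot k n G x) j) = residue k n G x j :> nat,
    arr s 0 = matrix_array x &
    forall j, j < n -> arr s 1 (k * n + j) = residue k n G x j :> nat]).
Proof.
move=> n0 kn Gf.
have n3 : n <= n ^ 3 by rewrite -{1}(expn1 n) leq_pexp2l.
apply: (@wp_seqB (10 * n) (fun s' =>
  [/\ reg s' 5 = 1, reg s' 6 = k * n & reg s' 7 = k.+1 * n])) => [||]; last lia.
  exact: init_spec.
move=> s1 U1 [r5 r6 r7].
have b1 : base n s1 by split; rewrite // ?(U1.1 0 isT) ?(U1.1 4 isT).
apply: (@prepare_spec k n G x s1) => //; last lia.
- by rewrite (U1.2 0 isT).
- by rewrite (U1.2 1 isT).
- by rewrite (U1.2 5 isT).
move=> s2 U2 M2 p2; have b2 := base_unch U2 b1 isT; have [t0 t4 t5] := b2.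
apply: wp_conseq.
- apply: (@emit_spec n k _ (is_pivot k n G x) (residue k n G x)) => //.
    by rewrite (U2.1 6 isT).
  by move=> j lj; rewrite M2.
- lia.
move=> s3 U3 [r3 e3]; split=> //.
- by split; [exact: (base_unch U3 b2 isT) | rewrite (U3.1 6 isT) (U2.1 6 isT)].
- by rewrite r3 unmarked_count.
- by rewrite (U3.2 0 isT) (U2.2 0 isT) (U1.2 0 isT).
- by move=> j lj; rewrite (U3.2 1 isT) M2.
Qed.

Lemma hamming_add n (x y u : word n) : hamming (x + u)%R (y + u)%R = hamming x y.
Proof.
by apply: eq_card => i; rewrite !inE !mxE (inj_eq (addIr _)).
Qed.

Lemma hamming_sym n (x y : word n) : hamming x y = hamming y x.
Proof. by apply: eq_card => i; rewrite !inE eq_sym. Qed.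

Lemma bob_spec (R : realType) (alpha : R) k n (C : {set word n}) (G : 'M['F_2]_(k, n))
    (L T e : nat) (D : cmd) (x y : word n) (m : seq bool) :
  0 < n -> generator_matrix C G -> list_decodable alpha L C ->
  list_decodes alpha D C G T ->
  Defs.close alpha x y -> n * L ^ 2 + 2 < 2 ^ (up_log 2 n.+1 * e) ->
  (forall j, j < n -> ~~ is_pivot k n G x j ->
     nth false m (unmarked_before (is_pivot k n G x) j) = residue k n G x j) ->
  wp (bob_prog D e) (receive m (input_store G y))
    (T + (250 + 11 * e) * (L ^ 3 * n ^ 3)) (fun s => exists M off,
    [/\ base n s, reg s 3 = up_log 2 n.+1 * e,
        0 < M /\ binval (fun j => arr s 3 j != 0) (up_log 2 n.+1 * e) = M,
        arr s 8 (binval (fun j => bits n x j (+) residue k n G x j) n %% M) = off &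
        forall j, j < n -> arr s 6 j = residue k n G x j :> nat /\
          (arr s 19 (off + j) != 0) = bits n x j (+) residue k n G x j]).
Proof.
move=> n0 [Gf GC] lC Ddec cxy eL hm.
have kn : k <= n by have := rank_leq_col G; rewrite (eqP Gf).
set B := up_log 2 n.+1 * e in eL *.
have leB : B <= n * e by rewrite leq_mul2r up_log_min ?orbT // ltn_expl.
pose u := of_bits n (residue k n G x); pose z : word n := (y + u)%R.
have [sD [tD [eD lD pD]]] := Ddec z.
pose l := reg sD 3; pose w i j := arr sD 3 (i * n + j) != 0.
have Ew i : output_word n (i * n) sD = of_bits n (w i) by apply/rowP => j; rewrite !mxE.
(* Translation by [u] preserves Hamming distance, so the codeword [x + u] lies in the ball around
   [z = y + u]. *)
have xuN : (x + u)%R \in neighbours alpha C z.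
  rewrite inE GC elim_last //= /Defs.close hamming_add hamming_sym.
  exact: cxy.
have ul : uniq (output_list n sD) by rewrite (perm_uniq pD) enum_uniq.
have lL : l <= L.
  by have := perm_size pD; rewrite size_mkseq -cardE /l => ->; apply: lC.
have [i0 li0 Ei0] : exists2 i0, i0 < l & of_bits n (w i0) = (x + u)%R.
  move: xuN; rewrite -mem_enum -(perm_mem pD) => /mapP[i].
  by rewrite mem_iota => /= li ->; exists i.
have l0 : 0 < l by apply: leq_ltn_trans li0.
have wi0 j : j < n -> w i0 j = bits n x j (+) residue k n G x j.
  by move=> lj; rewrite -(of_bitsE n (w i0)) // Ei0 bitsD // of_bitsE.
have injw i j : i < l -> j < l -> binval (w i) n = binval (w j) n -> i = j.
  move=> li lj /binval_inj E; move/mkseq_uniqP: ul; apply; rewrite ?inE //.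
  by rewrite !Ew; apply: eq_of_bits.
have [M0 /andP[M00 leM0] sepM0] := @exists_separating n l (fun i => binval (w i) n)
  (fun i _ => binval_lt (w i) n) injw.
have exM : exists M, (0 < M) && separates (fun i => binval (w i) n) l M.
  by exists M0; rewrite M00.
case: (ex_minnP exM) => M /andP[Mpos sepM] minM.
have leM : M <= n * L ^ 2 + 2.
  apply: leq_trans (minM M0 _) _; first by rewrite M00.
  apply: leq_trans leM0 _; rewrite leq_add2r leq_mul2l leq_exp2r // lL orbT; by [].
have ltM : M < 2 ^ B by apply: leq_ltn_trans eL.
have L0 : 0 < L by apply: leq_trans lL.
set X := L ^ 3 * n ^ 3.
have X3 : n ^ 3 <= X by rewrite leq_pmull // expn_gt0 L0.
have X1 : n <= X by apply: leq_trans X3; rewrite -{1}(expn1 n) leq_pexp2l.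
have X2 : k * n <= X.
  apply: leq_trans X3; apply: leq_trans (_ : n * n <= _); first by rewrite leq_mul2r kn orbT.
  by rewrite mulnn leq_pexp2l.
(* Cost of the search: [(n L^2 + 2) * L n <= 3 L^3 n^2], within the cubic budget. *)
have XM : M * (l * n) <= 3 * X.
  apply: leq_trans (_ : (n * L ^ 2 + 2) * (L * n) <= _).
    by rewrite leq_mul // leq_mul2r lL orbT.
  have h1 : n * L ^ 2 + 2 <= 3 * (n * L ^ 2).
    have h0 : 0 < n * L ^ 2 by rewrite muln_gt0 n0 expn_gt0 L0.
    by lia.
  apply: leq_trans (_ : 3 * (n * L ^ 2) * (L * n) <= _); first by rewrite leq_mul2r h1 orbT.
  have -> : 3 * (n * L ^ 2) * (L * n) = 3 * (L ^ 3 * n ^ 2) by rewrite !expnS !expn0; nia.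
  by rewrite leq_mul2l /= leq_mul2l leq_pexp2l ?orbT.
have Xe : n * e <= e * X by rewrite mulnC leq_mul2l X1 orbT.
have eT : (250 + 11 * e) * X = 250 * X + 11 * (e * X) by rewrite mulnDl mulnA.
have eW : (3 * e + 12) * n = 3 * (n * e) + 12 * n by rewrite mulnDl -mulnA (mulnC e).
rewrite eT.
apply: (@wp_seqB (10 * n) (fun s' =>
  [/\ reg s' 5 = 1, reg s' 6 = k * n & reg s' 7 = k.+1 * n])) => [||]; last by clear -X1; lia.
  exact: init_spec.
move=> s1 U1 [r5 r6 r7].
have b1 : base n s1 by split; rewrite // ?(U1.1 0 isT) ?(U1.1 4 isT).
apply: (@wp_seqB (4 * (k * n) + 2) (fun s' =>
    forall q, arr s' 17 q = matrix_array G q)) => [||]; last by lia.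
  apply: wp_conseq; [exact: (@copy_spec (k * n)) | by [] |].
  move=> s2 U2 E q; rewrite E (U1.2 1 isT) (U1.2 17 isT) /=.
  by case: ltnP => // /matrix_array_out ->.
move=> s2 U2 a17; have b2 := base_unch U2 b1 isT.
apply: (@prepare_spec k n G y s2) => //; try lia.
- by rewrite (U2.1 6 isT).
- by rewrite (U2.1 7 isT).
- by rewrite (U2.2 0 isT) (U1.2 0 isT).
- by rewrite (U2.2 1 isT) (U1.2 1 isT).
- by rewrite (U2.2 5 isT) (U1.2 5 isT).
move=> s3 U3 M3 p3; have b3 := base_unch U3 b2 isT; have [t0 t4 t5] := b3.
(* Bob eliminated with [y] as the appended row, Alice with [x]; the pivots agree. *)
have Ep j : is_pivot k n G y j = is_pivot k n G x j by apply: marked_augmented.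
apply: (@wp_seqB (20 * n) (fun s' =>
    (forall j, j < n -> arr s' 6 j = residue k n G x j :> nat) /\
    forall j, arr s' 16 j =
       if j < n then bits n y j (+) residue k n G x j : nat else arr s3 16 j)) => [||];
  last by lia.
  apply: (@shift_word_spec n s3 (is_pivot k n G x)) => //.
  - by move=> j _; rewrite p3 Ep.
  - by move=> j _; rewrite (U3.2 0 isT) (U2.2 0 isT) (U1.2 0 isT); apply: matrix_array_bit.
  - by move=> j lj pj; rewrite (U3.2 2 isT) (U2.2 2 isT) (U1.2 2 isT); congr nat_of_bool; apply: hm.
  - by move=> j _; apply: marked_last.
  - by rewrite (U3.2 6 isT) (U2.2 6 isT) (U1.2 6 isT).
move=> s4 U4 [a6 a16]; have b4 := base_unch U4 b3 isT.
apply: (@wp_seqB 2 (fun s' => reg s' 64 = n /\ reg s' 65 = k)) => [||]; last by lia.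
  apply: wp_ev => //=; rewrite /upd /=; split; first by case: b4.
  by rewrite (U4.1 1 isT) (U3.1 1 isT) (U2.1 1 isT) (U1.1 1 isT).
move=> s5 U5 [r64 r65]; have b5 := base_unch U5 b4 isT.
(* The upper memory is the image of a fresh input store for [z]: [z] in array 16, [G] in array 17,
   zeros elsewhere. *)
have sh : relocated (input_store G z) s5.
  split=> [[|[|i]]|[|[|a]] p] //=.
  - by rewrite !(U5.1 (64 + i.+2) isT, U4.1 (64 + i.+2) isT, U3.1 (64 + i.+2) isT, U2.1 (64 + i.+2) isT, U1.1 (64 + i.+2) isT).
  - rewrite (U5.2 16 isT) a16; case: ltnP => lp.
      by rewrite matrix_array_bit -/(bits n z p) /z bitsD // of_bitsE.
    rewrite matrix_array_out ?mul1n // (U3.2 16 isT) (U2.2 16 isT) (U1.2 16 isT); by [].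
  - by rewrite (U5.2 17 isT) (U4.2 17 isT) (U3.2 17 isT) a17.
  - by rewrite !(U5.2 (16 + a.+2) isT, U4.2 (16 + a.+2) isT, U3.2 (16 + a.+2) isT, U2.2 (16 + a.+2) isT, U1.2 (16 + a.+2) isT).
have [s6 [e6 sh6]] := exec_relocate _ _ _ _ eD _ sh.
apply: (@wp_seqB tD (fun s' => s' = s6)) => [||]; [by exists s6, tD | | lia].
move=> s6' U6 E6; subst s6'.
have f6 r : r < 64 -> reg s6 r = reg s5 r by move=> lr; rewrite U6.1 ?modr_relocate.
have g6 a : a < 16 -> arr s6 a = arr s5 a by move=> la; rewrite U6.2 ?moda_relocate.
have b6 : base n s6 by case: b5 => c0 c4 c5; split; rewrite f6.
have [c0 c4 c5] := b6.
apply: (@wp_seqB (40 * (M * (l * n))) (fun s' => reg s' 20 = M /\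
     forall i, i < l -> arr s' 8 (binval (w i) n %% M) = i * n)) => [||]; last by clear -XM X1 X2 X3 n0 lD; lia.
- apply: (@search_spec n l w M) => //.
  + exact: (sh6.1 3).
  + by move=> i j li lj; rewrite (sh6.2 3).
  + by move=> v; rewrite g6 // (U5.2 7 isT) (U4.2 7 isT) (U3.2 7 isT) (U2.2 7 isT) (U1.2 7 isT).
  + move=> q /andP[q0 lq]; apply/negP => sq; have := minM q.
    by rewrite q0 sq leqNgt lq => /(_ isT).
move=> s7 U7 [r20 a8]; have b7 := base_unch U7 b6 isT; have [d0 d4 d5] := b7.
apply: (@wp_seqB ((3 * e + 12) * n) (fun s' =>
    reg s' 30 = B /\ reg s' 31 = 2 ^ B)) => [||]; last by rewrite eW; clear -XM X1 X2 X3 Xe n0 lD; lia.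
- exact: width_spec.
move=> s8 U8 [r30 r31]; have b8 := base_unch U8 b7 isT.
apply: (@wp_seqB 1 (fun s' => reg s' 35 = M)) => [||]; last by rewrite eW; clear -XM X1 X2 X3 Xe n0 lD; lia.
- by apply: wp_ev => //=; rewrite /upd /= (U8.1 20 isT).
move=> s9 U9 r35; have b9 := base_unch U9 b8 isT; have [h0 h4 h5] := b9.
apply: wp_conseq; first apply: (@encode_spec B M s9) => //.
- by rewrite (U9.1 30 isT).
- by rewrite (U9.1 31 isT).
- by rewrite eW; clear -XM X1 X2 X3 Xe n0 lD leB; lia.
move=> s10 U10 [r3 v3]; exists M, (i0 * n); split=> //.
- exact: (base_unch U10 b9 isT).
- rewrite (U10.2 8 isT) (U9.2 8 isT) (U8.2 8 isT) -(a8 i0) //.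
  by congr (arr s7 8 (_ %% _)); apply: eq_binval => j lj; rewrite wi0.
move=> j lj; split.
  by rewrite (U10.2 6 isT) (U9.2 6 isT) (U8.2 6 isT) (U7.2 6 isT) g6 // (U5.2 6 isT) a6.
by rewrite (U10.2 19 isT) (U9.2 19 isT) (U8.2 19 isT) (U7.2 19 isT) (sh6.2 3) -wi0.
Qed.

(** Alice's memory still holds [u] in row [k] of array 1, so she can form [x + u]; its residue is
    below [M], hence fits in the common width. *)
Lemma alice2_spec k n e M (x v : nat -> bool) (m : seq bool) s :
  let B := up_log 2 n.+1 * e in
  0 < n -> base n s -> reg s 6 = k * n ->
  (forall j, j < n -> arr s 0 j = x j :> nat) ->
  (forall j, j < n -> arr s 1 (k * n + j) = v j :> nat) ->
  size m = B -> binval (nth false m) B = M -> 0 < M -> M <= 2 ^ B ->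
  wp (alice2_prog e) (receive m s) (50 * n + 16 * (n * e))
    (fun s' => reg s' 3 = B /\ binval (fun j => arr s' 3 j != 0) B =
       binval (fun j => x j (+) v j) n %% M).
Proof.
move=> B n0 [s0 s4 s5] s6 sx sv sm vm M0 MB.
have b0 : base n (receive m s) by [].
have leB : B <= n * e by rewrite leq_mul2r up_log_min ?orbT // ltn_expl.
have eW : (3 * e + 12) * n = 3 * (n * e) + 12 * n by rewrite mulnDl -mulnA (mulnC e).
apply: (@wp_seqB (5 * B + 3) (fun s' => reg s' 36 = M)) => [||]; last by lia.
  by rewrite -vm; apply: decode_spec.
move=> s1 U1 r36; have b1 := base_unch U1 b0 isT; have [c0 c4 c5] := b1.
apply: (@wp_seqB 1 (fun s' => reg s' 20 = M)) => [||]; [|  | lia].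
  by apply: wp_ev => //=; rewrite /upd /=.
move=> s2 U2 r20; have b2 := base_unch U2 b1 isT; have [d0 d4 d5] := b2.
apply: (@wp_seqB (9 * n + 2) (fun s' =>
    forall j, j < n -> arr s' 6 j = x j (+) v j :> nat)) => [||]; last by lia.
  apply: (@sum_spec n k) => //.
  - by rewrite (U2.1 6 isT) (U1.1 6 isT).
  - by move=> j lj; rewrite (U2.2 0 isT) (U1.2 0 isT) -sx.
  - by move=> j lj; rewrite (U2.2 1 isT) (U1.2 1 isT) -sv.
move=> s3 U3 a6; have b3 := base_unch U3 b2 isT.
apply: (@wp_seqB 1 (fun s' => reg s' 22 = 0)) => [||]; [exact: wp_ev |  | lia].
move=> s4' U4 r22; have b4 := base_unch U4 b3 isT; have [f0 f4 f5] := b4.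
apply: (@wp_seqB (15 * n) (fun s' =>
    reg s' 21 = binval (fun j => x j (+) v j) n %% M)) => [||]; last by lia.
  apply: (hash_spec 6 n s4' M 0) => //.
  - by rewrite (U4.1 20 isT) (U3.1 20 isT).
  - by move=> j lj; rewrite (U4.2 6 isT) a6 //; case: (_ (+) _).
move=> s5' U5 r21; have b5 := base_unch U5 b4 isT; have [g0 g4 g5] := b5.
apply: (@wp_seqB ((3 * e + 12) * n) (fun s' =>
    reg s' 30 = B /\ reg s' 31 = 2 ^ B)) => [||]; last by lia.
  exact: width_spec.
move=> s6' U6 [r30 r31]; have b6 := base_unch U6 b5 isT.
apply: (@wp_seqB 1 (fun s' =>
    reg s' 35 = binval (fun j => x j (+) v j) n %% M)) => [||]; last by lia.
  by apply: wp_ev => //=; rewrite /upd /= (U6.1 21 isT).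
move=> s7 U7 r35; have b7 := base_unch U7 b6 isT; have [h0 h4 h5] := b7.
apply: wp_conseq;
  first apply: (@encode_spec B (binval (fun j => x j (+) v j) n %% M) s7) => //.
- by apply: leq_trans MB; rewrite ltn_pmod.
- by rewrite (U7.1 30 isT) r30.
- by rewrite (U7.1 31 isT) r31.
- by rewrite eW; lia.
- by [].
Qed.

(** The received residue indexes array 8, which points to [x + u] in the decoded list; adding [u]
    from array 6 gives [x]. *)
Lemma final_spec n B h (x v : nat -> bool) (m : seq bool) s off :
  0 < n -> base n s -> size m = B -> binval (nth false m) B = h ->
  arr s 8 h = off ->
  (forall j, j < n -> arr s 6 j = v j :> nat /\
     (arr s 19 (off + j) != 0) = x j (+) v j) ->
  wp final_prog (receive m s) (5 * B + 20 * n)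
    (fun s' => forall j, j < n -> arr s' 3 j = x j :> nat).
Proof.
move=> n0 [s0 s4 s5] sm vm s8 sxv.
have b0 : base n (receive m s) by [].
apply: (@wp_seqB (5 * B + 3) (fun s' => reg s' 36 = h)) => [||]; last by lia.
  by rewrite -vm; apply: decode_spec.
move=> s1 U1 r36; have b1 := base_unch U1 b0 isT.
apply: (@wp_seqB 1 (fun s' => reg s' 22 = off)) => [||]; [|  | lia].
  by apply: wp_ev => //=; rewrite /upd /= r36 (U1.2 8 isT).
move=> s2 U2 r22; have b2 := base_unch U2 b1 isT; have [d0 d4 d5] := b2.
apply: wp_conseq; first apply: (@output_spec n s2 off (fun j => x j (+) v j) v) => //.
- by move=> j /sxv[_ <-]; rewrite (U2.2 19 isT) (U1.2 19 isT).
- by move=> j /sxv[<- _]; rewrite (U2.2 6 isT) (U1.2 6 isT).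
- by lia.
- by move=> s3 _ h3 j lj; rewrite h3 // addbK.
Qed.

End Turns.

                                          

(** * Message width and the complete run *)

Section Synchronization.
Local Open Scope nat_scope.

Lemma card_code k n (C : {set word n}) (G : 'M['F_2]_(k, n)) :
  generator_matrix C G -> #|C| = 2 ^ k.
Proof.
move=> [Gf GC]; have -> : C = [set (v *m G)%R | v : word k]%SET.
  apply/setP => z; rewrite GC; apply/submxP/imsetP => [[v ->]|[v _ ->]];
  by exists v.
by rewrite card_imset ?card_mx ?card_Fp // ?mul1n //; apply: row_free_inj.
Qed.

(** The factor [e] must be one constant for all lengths, since it is written into the programs. *)
Lemma exists_width (lengths : pred nat) (L : nat -> nat) :
  polynomially_bounded lengths L -> exists e, forall n, n \in lengths -> 0 < n ->
    n * L n ^ 2 + 2 < 2 ^ (up_log 2 n.+1 * e).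
Proof.
move=> [p hp]; pose S := \sum_(i < size p) (p`_i)%R; pose d := size p.
exists (3 + 2 * (S + d)) => n /hp Lp n0; set u := up_log 2 n.+1.
have nu : n.+1 <= 2 ^ u by apply: up_logP.
have u0 : 0 < u by rewrite up_log_gt0.
set Q := 2 ^ (u * (S + d)).
(* With [n < 2 ^ u], each monomial is at most [2 ^ (u * d)], and the coefficient sum satisfies
   [S <= 2 ^ S <= 2 ^ (u * S)]. *)
have pQ : p.[n]%R <= Q.
  rewrite horner_coef; apply: leq_trans (_ : S * 2 ^ (u * d) <= _).
    rewrite /S big_distrl /=; apply: leq_sum => i _.
    rewrite leq_mul2l; apply/orP; right; rewrite natrXE.
    apply: leq_trans (_ : (2 ^ u) ^ i <= _).
      by case: (nat_of_ord i) => // q; rewrite leq_exp2r // ltnW.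
    by rewrite -expnM leq_exp2l // leq_mul2l ltnW ?orbT // ltn_ord.
  rewrite /Q mulnDr expnD leq_mul2r; apply/orP; right.
  by apply: leq_trans (ltnW (ltn_expl S (ltnSn 1))) _; rewrite leq_exp2l // leq_pmull.
have Q0 : 0 < Q by rewrite expn_gt0.
have -> : 2 ^ (u * (3 + 2 * (S + d))) = 2 ^ u * (2 ^ u * 2 ^ u) * Q ^ 2.
  by rewrite /Q -expnM -!expnD; congr (2 ^ _); nia.
have u2 : 2 <= 2 ^ u by rewrite -{1}(expn1 2) leq_exp2l.
have LQ : L n ^ 2 <= Q ^ 2 by rewrite leq_sqr (leq_trans Lp).
have Q20 : 0 < Q ^ 2 by rewrite expn_gt0 Q0.
apply: leq_ltn_trans (_ : n * Q ^ 2 + 2 * Q ^ 2 < _).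
  by rewrite leq_add // ?leq_mul2l ?LQ ?orbT // leq_pmulr.
rewrite -mulnDl ltn_pmul2r //.
have : 2 ^ u * 4 <= 2 ^ u * (2 ^ u * 2 ^ u) by rewrite leq_mul2l (leq_mul u2 u2) orbT.
by lia.
Qed.

Lemma sq_up_log n : 0 < n -> up_log 2 n.+1 ^ 2 <= 8 * n.
Proof.
move=> n0; have u0 : 0 < up_log 2 n.+1 by rewrite up_log_gt0.
have : 2 ^ (up_log 2 n.+1).-1 < n.+1 by apply: up_log_gtn.
case: (up_log 2 n.+1) u0 => // u _ /=; rewrite ltnS => le.
apply: leq_trans (_ : 8 * 2 ^ u <= _); last by rewrite leq_mul2l le.
elim: u {le} => // u IH; move: IH; rewrite !expnS !expn0; case: u => [|[|u]] //; nia.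
Qed.

Lemma run_spec (R : realType) (alpha : R) k n (C : {set word n}) (G : 'M['F_2]_(k, n))
    (L T e : nat) (D : cmd) (x y : word n) :
  0 < n -> generator_matrix C G -> list_decodable alpha L C -> 0 < L ->
  list_decodes alpha D C G T ->
  n * L ^ 2 + 2 < 2 ^ (up_log 2 n.+1 * e) -> Defs.close alpha x y ->
  exists tr t,
    [/\ run (Protocol true [:: alice1_prog; bob_prog D e; alice2_prog e] final_prog)
          G x y tr x t,
        map size tr = [:: n - k; up_log 2 n.+1 * e; up_log 2 n.+1 * e] &
        t <= T + (401 + 32 * e) * (L ^ 3 * n ^ 3)].
Proof.
move=> n0 gen lC L0 Ddec eL cxy; have [Gf _] := gen.
set B := up_log 2 n.+1 * e in eL *.
have leB : B <= n * e by rewrite leq_mul2r up_log_min ?orbT // ltn_expl.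
have kn : k <= n by have := rank_leq_col G; rewrite (eqP Gf).
have [sA [tA [eA lA [[bA rA6] rA3 aA3 aA0 aA1]]]] := @alice1_spec k n G x n0 kn Gf.
have szA : size (sent sA) = n - k by rewrite size_mkseq.
have hm j : j < n -> ~~ is_pivot k n G x j ->
    nth false (sent sA) (unmarked_before (is_pivot k n G x) j) = residue k n G x j.
  move=> lj pj; rewrite nth_mkseq ?aA3 //; first by case: residue.
  by rewrite rA3 -(unmarked_count k n G x Gf n0) unmarked_before_lt.
have [sB [tB [eB lB [M [off [bB rB3 [M0 vM] aB8 aB]]]]]] :=
  @bob_spec R alpha k n C G L T e D x y (sent sA) n0 gen lC Ddec cxy eL hm.
have szB : size (sent sB) = B by rewrite size_mkseq.
have vB : binval (nth false (sent sB)) B = M.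
  by rewrite -vM; apply: eq_binval => j lj; rewrite nth_mkseq // rB3.
have MB : M <= 2 ^ B by rewrite -vM ltnW // binval_lt.
have xA j : j < n -> arr sA 0 j = bits n x j :> nat.
  by move=> lj; rewrite aA0; apply: matrix_array_bit.
have [sA' [tA' [eA' lA' [rA'3 vA']]]] :=
  @alice2_spec k n e M (bits n x) (residue k n G x) (sent sB) sA n0 bA rA6 xA aA1 szB vB M0 MB.
have szA' : size (sent sA') = B by rewrite size_mkseq.
have vA'' : binval (nth false (sent sA')) B =
    binval (fun j => bits n x j (+) residue k n G x j) n %% M.
  by rewrite -vA'; apply: eq_binval => j lj; rewrite nth_mkseq // rA'3.
have [sF [tF [eF lF aF]]] :=
  @final_spec n B _ (bits n x) (residue k n G x) (sent sA') sB off n0 bB szA' vA'' aB8 aB.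
exists [:: sent sA; sent sB; sent sA'], (tA + (tB + (tA' + 0)) + tF); split.
- exists (receive (sent sA') sB), sF, (tA + (tB + (tA' + 0))), tF; split=> //.
  + apply: SessionAlice eA _; apply: SessionBob eB _; apply: SessionAlice eA' _.
    exact: SessionEnd.
  + apply/rowP => j; rewrite mxE add0n aF // bitsE.
    by rewrite -[LHS]F2_bit; case: (x 0%R j != 0%R).
- by rewrite /= szA szB szA'.
(* The constants add up over the three turns and the final program: [81 + 250 + 50 + 20 = 401], and
   [11 + 16 + 5 = 32] for the terms in [n * e]. *)
- set X := L ^ 3 * n ^ 3.
  have X3 : n ^ 3 <= X by rewrite leq_pmull // expn_gt0 L0.
  have X1 : n <= X by apply: leq_trans X3; rewrite -{1}(expn1 n) leq_pexp2l.
  have Xe : n * e <= e * X by rewrite mulnC leq_mul2l X1 orbT.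
  have eT : (401 + 32 * e) * X = 401 * X + 32 * (e * X) by rewrite mulnDl mulnA.
  have eT' : (250 + 11 * e) * X = 250 * X + 11 * (e * X) by rewrite mulnDl mulnA.
  rewrite -/X eT' in lB; rewrite eT.
  clear -lA lB lA' lF X3 X1 Xe leB; lia.
Qed.

End Synchronization.

(** * The error term and the theorem *)

Lemma little_o_of_sq_le (R : realType) (f : nat -> R) (K : nat) :
  (forall n, (0 < n)%N -> f n ^+ 2 <= K%:R * n%:R) ->
  (fun n : nat => f n / n%:R) @ \oo --> (0 : R).
Proof.
move=> h; apply/cvgr0Pnorm_lt => eps eps0; near=> n.
have n0 : (0 < n)%N by near: n; exists 1%N.
have nR : (0 : R) < n%:R by rewrite ltr0n.
have big : K%:R / eps ^+ 2 < n%:R by near: n; apply: nbhs_infty_gtr.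
rewrite -(ltr_pXn2r (ltn0Sn 1)) ?nnegrE ?normr_ge0 ?ltW // real_normK ?num_real //.
rewrite expr_div_n ltr_pdivrMr ?exprn_gt0 //; apply: le_lt_trans (h n n0) _.
rewrite [n%:R ^+ 2]expr2 mulrA ltr_pM2r // mulrC -ltr_pdivrMr ?exprn_gt0 //.
Unshelve. all: by end_near.
Qed.

Theorem mainTheorem4 (R : realType) (alpha rate : R)
    (lengths : pred nat) (C : forall n : nat, {set word n})
    (k : nat -> nat) (G : forall n : nat, 'M['F_2]_(k n, n))
    (L : nat -> nat) (D : cmd) (Tcode : nat -> nat)
    (alpha_ge0 : 0 <= alpha)
    (lengths_gt0 : forall n, n \in lengths -> (0 < n)%N)
    (C_rate : forall n, n \in lengths -> has_rate rate (C n))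
    (C_list : forall n, n \in lengths -> list_decodable alpha (L n) (C n))
    (C_linear : forall n, n \in lengths -> linear_code (C n))
    (G_gen : forall n, n \in lengths -> generator_matrix (C n) (G n))
    (L_poly : polynomially_bounded lengths L)
    (D_decodes : forall n, n \in lengths ->
       list_decodes alpha D (C n) (G n) (Tcode n))
    (D_efficient : polynomially_bounded lengths Tcode) :
  exists (P : protocol) (e : nat -> R) (c : nat),
    [/\ rounds 3 P,
        (fun n : nat => e n / n%:R) @ \oo --> (0 : R)
      & forall n, n \in lengths ->
        exists (tr : word n -> word n -> seq (seq bool))
               (time : word n -> word n -> nat),
          [/\ synchronizes alpha P (G n) tr time,
              self_delimiting alpha tr,
              (worst_case alpha (communication tr))%:R
                = (1 - rate) * n%:R + e n
            & (worst_case alpha time <= Tcode n + c * (L n ^ 3 * n ^ 3))%N]].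
Proof.
have [w hw] := exists_width lengths L L_poly.
pose B n := (up_log 2 n.+1 * w)%N.
(* Chosen so that [(1 - rate) * n + e n] is exactly [n - k + 2B]; the value 0 off [lengths] keeps
   the limit over all [n] meaningful. *)
pose e n : R := if n \in lengths then rate * n%:R - (k n)%:R + (B n + B n)%:R else 0.
exists (Protocol true [:: alice1_prog; bob_prog D w; alice2_prog w] final_prog), e,
  (401 + 32 * w)%N.
split=> //.
  apply: (@little_o_of_sq_le _ _ ((1 + 2 * w) ^ 2 * 8)) => n n0.
  rewrite /e; case: ifP => [nl|_]; last by rewrite expr0n mulr_ge0.
  have [m cm rm] := C_rate n nl.
  have Em : m = k n.
    by apply/eqP; rewrite -(@eqn_exp2l 2) // -cm (card_code _ _ _ _ (G_gen n nl)).
  rewrite Em in rm.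
  have u1 : (0 < up_log 2 n.+1)%N by rewrite up_log_gt0.
  set z := _ + _.
  (* The rounding of the rate contributes less than 1, which is absorbed by one copy of the positive
     logarithm. *)
  have zle : `|z| <= ((1 + 2 * w) * up_log 2 n.+1)%:R.
    apply: le_trans (ler_normD _ _) _; rewrite distrC in rm.
    apply: le_trans (lerD (ltW rm) (lexx _)) _.
    rewrite ger0_norm // nat1r ler_nat /B; nia.
  rewrite -(real_normK (num_real z)).
  apply: le_trans (_ : ((1 + 2 * w) * up_log 2 n.+1)%:R ^+ 2 <= _).
    by rewrite ler_sqr ?nnegrE.
  rewrite -natrX -natrM ler_nat expnMn -mulnA leq_mul2l sq_up_log ?orbT //.
move=> n nl; have n0 := lengths_gt0 n nl.
have gen := G_gen n nl.
have kn : (k n <= n)%N by have [Gf _] := gen; have := rank_leq_col (G n); rewrite (eqP Gf).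
have close0 (x : word n) : Defs.close alpha x x.
  by rewrite /Defs.close /hamming eq_card0 ?mulr_ge0 // => i; rewrite !inE eqxx.
(* The ball around 0 contains the codeword 0. Positivity of [L n] lets [n ^ 3] be absorbed into
   [L n ^ 3 * n ^ 3]. *)
have L0 : (0 < L n)%N.
  apply: leq_trans (C_list n nl 0); apply/card_gt0P; exists 0.
  by rewrite inE (C_linear n nl).1 close0.
(* Pairs violating the promise get a dummy transcript, so that choice yields total functions. *)
have ex (p : word n * word n) : exists q : seq (seq bool) * nat,
    Defs.close alpha p.1 p.2 ->
    [/\ run (Protocol true [:: alice1_prog; bob_prog D w; alice2_prog w] final_prog)
          (G n) p.1 p.2 q.1 p.1 q.2,
        map size q.1 = [:: (n - k n)%N; B n; B n] &
        (q.2 <= Tcode n + (401 + 32 * w) * (L n ^ 3 * n ^ 3))%N].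
  have [h|h] := boolP (Defs.close alpha p.1 p.2); last by exists ([::], 0%N).
  have [tr [t H]] := run_spec _ _ _ _ _ _ _ _ _ _ _ _ n0 gen (C_list n nl) L0
    (D_decodes n nl) (hw n nl n0) h.
  by exists (tr, t).
have [f hf] := boolp.choice ex.
exists (fun x y => (f (x, y)).1), (fun x y => (f (x, y)).2); split.
- by move=> x y h; have [] := hf (x, y) h.
- move=> x y x' y' h h' j _ /prefixP[s E].
  have [_ sz _] := hf (x, y) h; have [_ sz' _] := hf (x', y') h'.
  have szE (t : seq (seq bool)) i : size (nth [::] t i) = nth 0%N (map size t) i.
    by elim: t i => [|a t IH] [|i] /=.
  (* Message lengths do not depend on the inputs, so a prefix of the same length is the whole
     message. *)
  have := congr1 size E; rewrite size_cat !szE /= sz sz' -[LHS]addn0 => /addnI/esym/size0nil s0.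
  by rewrite E s0 cats0.
- rewrite /e nl.
  have -> : worst_case alpha (communication (fun x y => (f (x, y)).1)) =
      (n - k n + (B n + B n))%N.
    have comm p : Defs.close alpha p.1 p.2 ->
        communication (fun x y => (f (x, y)).1) p.1 p.2 = (n - k n + (B n + B n))%N.
      move=> h; rewrite /communication size_flatten /shape -surjective_pairing.
      by have [_ -> _] := hf p h; rewrite /= addn0.
    apply/eqP; rewrite eqn_leq; apply/andP; split.
      by apply/bigmax_leqP => p h; rewrite comm.
    (* The pair [(0, 0)] satisfies the promise, so the maximum is over a nonempty set and attains
       the common value. *)
    rewrite -(comm (0, 0)) //; exact: (leq_bigmax_cond (0, 0)).
  by rewrite natrD natrB //; ring.
- by apply/bigmax_leqP => p h; have := hf p h; rewrite -surjective_pairing => -[].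
Qed.
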